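(* Let $\mathcal{H}=\{rrr,rrb,yyb\}$. Then, as $n\to\infty$, $h_2(n,\mathcal{H})=\Omega\!\left(n^{2/3}/\log^{1/3}n\right)$ and $h_2(n,\mathcal{H})=O\!\left(n^{2/3}\sqrt{\log n}\right)$.
   Context: Edge-colorings of the complete graph $K_n$ use colors from $\{r,b,y\}$ (red, blue, yellow); they need not be proper, and not all colors need be used. A pattern is an edge-colored triangle, denoted by the multiset of the colors of its three edges; e.g. $rrr$ is the all-red triangle, $rrb$ is the triangle with two red edges and one blue edge, and $yyb$ has two yellow edges and one blue edge. For a family $\mathcal{H}$ of patterns, $\operatorname{Forb}(n,\mathcal{H})$ is the set of all edge-colorings of $K_n$ with colors from $\{r,b,y\}$ in which no triangle has a coloring belonging to $\mathcal{H}$. For an edge-coloring $c$ of $K_n$, $h_2(c)$ is the maximum $k$ such that there is a set of $k$ vertices whose induced edges use at most two of the three colors. Finally, $h_2(n,\mathcal{H})=\min\{h_2(c): c\in\operatorname{Forb}(n,\mathcal{H})\}$. Here $\log$ is the base-2 logarithm. *)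

(* Defs.v *)
From HB Require Import structures.
From mathcomp Require Import all_boot all_order all_algebra.
From mathcomp Require Import reals exp.

Set Implicit Arguments.
Unset Strict Implicit.
Unset Printing Implicit Defensive.

Inductive color := Red | Blue | Yellow.

Definition nat_of_color (a : color) : nat :=
  match a with Red => 0 | Blue => 1 | Yellow => 2 end.

Definition color_of_nat (i : nat) : option color :=
  match i with 0 => Some Red | 1 => Some Blue | 2 => Some Yellow | _ => None end.

Lemma nat_of_colorK : pcancel nat_of_color color_of_nat.
Proof. by case. Qed.

HB.instance Definition _ := Countable.copy color (pcan_type nat_of_colorK).

Lemma color_enumP : Finite.axiom [:: Red; Blue; Yellow].
Proof. by case. Qed.

HB.instance Definition _ := isFinite.Build color color_enumP.

Notation edge n := {e : {set 'I_n} | #|e| == 2}.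

Notation coloring n := {ffun edge n -> color}.

(* A pattern is a multiset of three colors, encoded as a sequence that is only
   ever compared up to perm_eq. *)
Notation pattern := (seq color).

Definition edges_in n (S : {set 'I_n}) : {set edge n} :=
  [set e : edge n | val e \subset S].

Definition pattern_of n (c : coloring n) (T : {set 'I_n}) : pattern :=
  [seq c e | e in edges_in T].

Definition Forb n (H : seq pattern) : {set coloring n} :=
  [set c : coloring n | [forall T : {set 'I_n},
     (#|T| == 3) ==> ~~ has (perm_eq (pattern_of c T)) H]].

Definition colors_in n (c : coloring n) (S : {set 'I_n}) : {set color} :=
  [set c e | e in edges_in S].

Definition h2 n (c : coloring n) : nat :=
  \max_(S : {set 'I_n} | #|colors_in c S| <= 2) #|S|.

(* h2 c <= n for every coloring c, so taking n as the neutral element of the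
   iterated minimum does not affect the minimum when Forb n H is nonempty. *)
Definition h2_min n (H : seq pattern) : nat :=
  \big[Order.min/n]_(c in Forb n H) h2 c.

Definition log2 (R : realType) (x : R) : R := (ln x / ln 2)%R.

(* Main.v *)
(** Lower bound.  Put k = h2 c.  In an admissible coloring the red graph is
    triangle-free, and two vertices with a common red neighbour are joined by a
    yellow edge; as the closed yellow neighbourhood of a vertex spans no blue
    edge, at most k vertices are at red distance 0 or 2 from a given vertex.
    Let d ^ 2 be about k.  A red-independent set is grown greedily: as long as
    some vertex has at least d red neighbours among the remaining vertices, take
    all of these and discard their at most k neighbours, otherwise take a single
    vertex and discard its neighbours.  Each selected vertex costs at most d + 1
    vertices, so n <= (d + 1) * k, which is of order k ^ (3/2).

    Upper bound.  Split the vertices into n ^ (1/3) blobs of size n ^ (2/3),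
    color edges between blobs blue and color each blob red and yellow so that
    the red edges form a triangle-free graph whose independence number is the
    square root of (blob size) * log n.  Such a graph is the union of two
    blow-ups, after Hefty, Horn, King and Pfender.  Take V = [N] * [s] with its
    first projection and a random map rho : V -> [N], two random graphs on [N],
    and a maximal triangle-free subgraph H1, H2 of each.  Join u and v if their
    first projections are joined in H1 while rho u and rho v have no common
    neighbour in the second random graph, or symmetrically.  A large set I has a
    large image under one of the two maps, say under the first; only a small
    fraction of the pairs of I have a common neighbour in either graph, and
    revealing the first graph on the remaining pairs gives an edge of H1 that is
    kept, with a probability that beats the number of choices of I. *)
Require Import Defs.
From mathcomp Require Import all_boot all_order all_algebra.
From mathcomp Require Import zify.

Set Implicit Arguments.
Unset Strict Implicit.
Unset Printing Implicit Defensive.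

(** * Counting estimates: the probabilistic method with denominators cleared *)

Lemma expn_self_le_fact m : m ^ m <= 4 ^ m * m`!.
Proof.
have pm : m ^ m <= (m + m) ^_ m.
  rewrite ffact_prod -[X in _ ^ X]card_ord -prod_nat_const.
  by apply: leq_prod => i _; have := ltn_ord i; lia.
apply: (leq_trans pm); rewrite -bin_ffact leq_mul2r; apply/orP; right.
(* The binomial [C(2m, m)] is one term in the expansion of [(1 + 1) ^ (2m)]. *)
have -> : 4 ^ m = 2 ^ (m + m) by rewrite addnn -mul2n expnM.
rewrite -[X in X ^ _]/(1 + 1) expnDn.
have lt_m : m < (m + m).+1 by lia.
rewrite (bigD1 (Ordinal lt_m)) //= !exp1n !muln1.
exact: leq_addr.
Qed.

(** Division-free form of [C(n, m) <= (4n / m) ^ m]. *)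
Lemma bin_mul_expn_le n m : 'C(n, m) * m ^ m <= (4 * n) ^ m.
Proof.
apply: (leq_trans (leq_mul (leqnn _) (expn_self_le_fact m))).
rewrite mulnCA bin_ffact expnMn leq_mul2l; apply/orP; right.
rewrite ffact_prod -[X in _ ^ X]card_ord -prod_nat_const.
by apply: leq_prod => i _; lia.
Qed.

Lemma bin_le_expn n m : 'C(n, m) <= n ^ m.
Proof.
apply: (@leq_trans (n ^_ m)).
  by rewrite -bin_ffact leq_pmulr // fact_gt0.
rewrite ffact_prod -[X in _ ^ X]card_ord -prod_nat_const.
by apply: leq_prod => i _; lia.
Qed.

(** This is [(1 - 1/M) ^ M <= 1/2]. The first two terms of the expansion of [((M - 1) + 1) ^ M]
    already add up to at least twice the first. *)
Lemma double_expn_pred M : 0 < M -> 2 * M.-1 ^ M <= M ^ M.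
Proof.
case: M => // M _ /=; rewrite -[M.+1 in X in _ <= X ^ _]addn1 expnDn.
rewrite big_ord_recl big_ord_recl /= /bump /= !bin0 bin1 !exp1n !subn0.
rewrite !muln1 !mul1n subn1 /= addnA.
apply: leq_trans (leq_addr _ _).
rewrite expnS; nia.
Qed.

Lemma card_bigcup_le (I U : finType) (P : pred I) (F : I -> {set U}) :
  #|\bigcup_(i | P i) F i| <= \sum_(i | P i) #|F i|.
Proof.
elim/big_ind2: _ => [|m A n B mA nB|//]; first by rewrite cards0.
by rewrite (leq_trans (leq_card_setU _ _)) // leq_add.
Qed.

Lemma card_exists_le (I U : finType) (Q : I -> pred U) b c :
  (forall i, #|[set f | Q i f]| * c <= b) ->
  #|[set f | [exists i, Q i f]]| * c <= #|I| * b.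
Proof.
move=> Qb.
have sub : [set f | [exists i, Q i f]] \subset \bigcup_i [set f | Q i f].
  apply/subsetP => f; rewrite inE => /existsP[i Qi].
  by apply/bigcupP; exists i; rewrite ?inE.
apply: (leq_trans (leq_mul (subset_leq_card sub) (leqnn c))).
apply: (leq_trans (leq_mul (card_bigcup_le _ _) (leqnn c))).
by rewrite big_distrl -sum_nat_const; apply: leq_sum.
Qed.

Lemma card_family_prod (aT rT : finType) (F : aT -> {set rT}) :
  #|[set f : {ffun aT -> rT} | [forall x, f x \in F x]]| = \prod_x #|F x|.
Proof.
have -> : #|[set f : {ffun aT -> rT} | [forall x, f x \in F x]]|
          = #|family (fun x => mem (F x))|.
  by apply: eq_card => f; rewrite inE; apply/forallP/familyP.
by rewrite card_family foldrE big_map big_enum.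
Qed.

(** Independence of the values of a uniform [f]: each point of [X] contributes a factor [q / #|rT|]
    to the probability. *)
Lemma card_family_le (aT rT : finType) (X : {set aT}) (Q : aT -> {set rT}) q :
  (forall x, x \in X -> #|Q x| <= q) ->
  #|[set f : {ffun aT -> rT} | [forall x in X, f x \in Q x]]| * #|rT| ^ #|X|
    <= q ^ #|X| * #|rT| ^ #|aT|.
Proof.
move=> Qq; pose F x := if x \in X then Q x else [set: rT].
have -> : [set f : {ffun aT -> rT} | [forall x in X, f x \in Q x]]
          = [set f : {ffun aT -> rT} | [forall x, f x \in F x]].
  apply/setP => f; rewrite !inE; apply/forall_inP/forallP => H x.
    by rewrite /F; case: ifP => xX; rewrite ?inE //; apply: H.
  by move=> xX; have := H x; rewrite /F xX.
rewrite card_family_prod (bigID (mem X)) /=.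
have -> : \prod_(x | x \notin X) #|F x| = #|rT| ^ #|~: X|.
  rewrite -prod_nat_const; apply: eq_big => [x|x /negbTE xX]; rewrite ?inE //.
  by rewrite /F xX cardsT.
rewrite -mulnA -expnD [_ + #|X|]addnC cardsC leq_mul2r; apply/orP; right.
by rewrite -prod_nat_const; apply: leq_prod => x xX; rewrite /F xX; apply: Qq.
Qed.

Lemma subset_of_card (T : finType) (A : {set T}) m :
  m <= #|A| -> exists2 B : {set T}, B \subset A & #|B| = m.
Proof.
move=> mA; exists [set x in take m (enum A)].
  by apply/subsetP => x; rewrite inE => /mem_take; rewrite mem_enum.
rewrite cardsE (card_uniqP _) ?take_uniq ?enum_uniq // size_take -cardE.
by case: ltngtP mA.
Qed.

(** Having [m] hits means that some [m]-subset of [O i] consists of hits only; sum over these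
    subsets and over [i]. *)
Lemma card_many_hits_le (aT rT idx : finType) (O : idx -> {set aT})
    (Q : idx -> aT -> {set rT}) w q m :
  (forall i, #|O i| <= w) -> (forall i x, #|Q i x| <= q) ->
  #|[set f : {ffun aT -> rT} |
      [exists i, m <= #|[set x in O i | f x \in Q i x]|]]| * #|rT| ^ m
    <= #|idx| * ('C(w, m) * q ^ m * #|rT| ^ #|aT|).
Proof.
move=> Ow Qq.
pose R (i : idx) (f : {ffun aT -> rT}) :=
  m <= #|[set x in O i | f x \in Q i x]|.
have H i : #|[set f | R i f]| * #|rT| ^ m <= 'C(w, m) * q ^ m * #|rT| ^ #|aT|.
  have sub : [set f | R i f] \subset \bigcup_(X in [set X : {set aT} | X \subset O i & #|X| == m])
      [set f : {ffun aT -> rT} | [forall x in X, f x \in Q i x]].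
    apply/subsetP => f; rewrite inE => /subset_of_card[X XO Xm].
    apply/bigcupP; exists X.
      rewrite inE Xm eqxx andbT; apply: subset_trans XO _.
      by apply/subsetP => x; rewrite inE => /andP[].
    rewrite inE; apply/forall_inP => x xX.
    by have := subsetP XO x xX; rewrite inE => /andP[].
  apply: (leq_trans (leq_mul (subset_leq_card sub) (leqnn _))).
  apply: (leq_trans (leq_mul (card_bigcup_le _ _) (leqnn _))).
  rewrite big_distrl /=.
  apply: (@leq_trans (\sum_(X in [set X : {set aT} | X \subset O i & #|X| == m])
                       (q ^ m * #|rT| ^ #|aT|))).
    apply: leq_sum => X; rewrite inE => /andP[_ /eqP <-].
    by apply: card_family_le => x _; apply: Qq.
  rewrite sum_nat_const cards_draws -mulnA leq_mul2r; apply/orP; right.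
  exact: leq_bin2l.
exact: (card_exists_le H).
Qed.

(** A Chernoff-type bound: the mean number of hits is at most [w * q / #|rT|], and exceeding it
    [4 * r] times has probability at most [r ^ -m] for each index. The share 1/16 lets several bad
    events be excluded at once. *)
Lemma card_many_hits_small (aT rT idx : finType) (O : idx -> {set aT})
    (Q : idx -> aT -> {set rT}) w q m r :
  (forall i, #|O i| <= w) -> (forall i x, #|Q i x| <= q) ->
  0 < m -> 0 < #|rT| -> 16 * #|idx| <= r ^ m -> r * (4 * w * q) <= m * #|rT| ->
  16 * #|[set f : {ffun aT -> rT} |
      [exists i, m <= #|[set x in O i | f x \in Q i x]|]]| <= #|rT| ^ #|aT|.
Proof.
move=> Ow Qq m0 r0 Hr Hw.
have := @card_many_hits_le aT rT idx O Q w q m Ow Qq.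
set B := #|[set _ | _]|; set R := #|rT| in r0 Hw *; set W := R ^ #|aT|.
move=> H.
have Hbin := bin_mul_expn_le w m.
have p1 : 0 < R ^ m by rewrite expn_gt0 r0.
have p2 : 0 < m ^ m by rewrite expn_gt0 m0.
rewrite -(@leq_pmul2r (R ^ m * m ^ m)) ?muln_gt0 ?p1 //.
have h1 : 16 * B * (R ^ m * m ^ m) <= 16 * #|idx| * ((4 * w) ^ m * q ^ m * W).
  apply: (@leq_trans (16 * (#|idx| * ('C(w, m) * q ^ m * W)) * m ^ m)).
    by rewrite mulnA -(mulnA 16) leq_mul2r leq_mul2l H !orbT.
  apply: (@leq_trans (16 * #|idx| * (q ^ m * W) * ('C(w, m) * m ^ m))).
    by apply: eq_leq; lia.
  apply: (leq_trans (leq_mul (leqnn _) Hbin)).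
  by apply: eq_leq; lia.
apply: (leq_trans h1); rewrite -expnMn.
apply: (@leq_trans (r ^ m * (4 * w * q) ^ m * W)).
  by rewrite mulnA leq_mul2r leq_mul2r Hr !orbT.
rewrite -expnMn -expnMn mulnC leq_mul2l; apply/orP; right.
by rewrite [R * m]mulnC leq_exp2r.
Qed.

Lemma sum_card_exchange (T1 T2 : finType) (A : {set T1}) (B : {set T2})
    (R : T1 -> T2 -> bool) :
  \sum_(a in A) #|[set b in B | R a b]| = \sum_(b in B) #|[set a in A | R a b]|.
Proof.
have cardE1 (T : finType) (S : {set T}) (P : pred T) :
    #|[set x in S | P x]| = \sum_(x in S) P x.
  by rewrite -sum1dep_card big_mkcondr; apply: eq_bigr => x _; case: (P x).
under eq_bigr do rewrite cardE1; rewrite exchange_big.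
by apply: eq_bigr => b _; rewrite cardE1.
Qed.

(** * Pairs with a common neighbour in a blow-up of a locally sparse graph *)

Definition linked (T : finType) (E : rel T) : rel T :=
  fun u v => [exists a, E a u && E a v].

Definition locally_sparse (T : finType) (E : rel T) t c :=
  forall A B : {set T}, #|A| <= t -> #|B| <= t ->
  \sum_(a in A) #|[set b in B | E a b]| <= c * t.

(* An edge in the blow-up of E along pi stands for up to sigma ^ 2 pairs of V, but
   a vertex a of T links pairs of I only inside X a.  The a with X a > 2 c sigma
   are fewer than t by local sparsity, so they contribute little to the sum of
   the (X a) ^ 2, and the other a are controlled by the sum of the X a. *)
Section LinkedPairs.
Variables (T V : finType) (E : rel T) (pi : V -> T) (I : {set V}).
Variables (sigma t c D : nat).
Hypothesis Esym : symmetric E.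
Hypothesis degE : forall a, #|[set b | E a b]| <= D.
Hypothesis Esparse : locally_sparse E t c.
Hypothesis fiber_le : forall b, #|[set v | pi v == b]| <= sigma.
Hypothesis cardI : #|I| = sigma * t.
Hypothesis t_gt0 : 0 < t.

Let X a := #|[set u in I | E a (pi u)]|.

Lemma sum_fiber_le (J : {set T}) (F : T -> nat) :
  \sum_(u in I | pi u \in J) F (pi u) <= sigma * \sum_(b in J) F b.
Proof.
rewrite (partition_big pi (mem J)) /=; last by move=> u /andP[].
rewrite big_distrr; apply: leq_sum => b bJ /=.
rewrite (eq_bigr (fun=> F b)); last by move=> u /andP[_ /eqP ->].
rewrite sum_nat_const leq_mul2r; apply/orP; right.
apply: leq_trans (fiber_le b); apply: subset_leq_card.
by apply/subsetP => u; rewrite !inE => /andP[_].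
Qed.

Lemma nbr_card_le a : X a <= sigma * D.
Proof.
apply: (@leq_trans (\sum_(u in I | pi u \in [set b | E a b]) 1)).
  rewrite sum1dep_card; apply: subset_leq_card; apply/subsetP => u.
  by rewrite !inE.
apply: (leq_trans (sum_fiber_le _ (fun=> 1))).
by rewrite sum1_card leq_mul2l degE orbT.
Qed.

Lemma sum_nbr_le : \sum_a X a <= #|I| * D.
Proof.
have -> : \sum_a X a = \sum_(a in [set: T]) X a by apply: eq_bigl => a; rewrite inE.
rewrite /X (sum_card_exchange _ _ (fun a u => E a (pi u))).
rewrite -sum_nat_const; apply: leq_sum => u _.
apply: leq_trans (degE (pi u)); apply: subset_leq_card.
by apply/subsetP => a; rewrite !inE Esym.
Qed.

(** Count from the side of [I]. By sparsity at most [t] points of [T] have more than [c] neighbours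
    in [A], and sparsity again bounds the edges at these points; every other [u] in [I] contributes
    at most [c]. *)
Lemma sum_nbr_small_le (A : {set T}) : #|A| <= t ->
  \sum_(a in A) X a <= 2 * c * sigma * t.
Proof.
move=> At; pose e j := #|[set a in A | E a j]|.
pose J := [set j | c < e j].
have Jt : #|J| <= t.
  rewrite leqNgt; apply/negP => /ltnW/subset_of_card[B BJ Bt].
  have := Esparse At (eq_leq Bt); rewrite sum_card_exchange.
  apply/negP; rewrite -ltnNge; apply: (@leq_trans (c.+1 * t)).
    by rewrite ltn_pmul2r.
  rewrite -Bt mulnC -sum_nat_const; apply: leq_sum => j /(subsetP BJ).
  by rewrite inE.
rewrite /X (sum_card_exchange _ _ (fun a u => E a (pi u))).
rewrite (bigID (fun u => pi u \in J)) /=.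
apply: (@leq_trans (sigma * (c * t) + #|I| * c)); last by rewrite cardI; lia.
apply: leq_add.
  apply: (leq_trans (sum_fiber_le _ e)); rewrite leq_mul2l.
  by rewrite -sum_card_exchange Esparse ?orbT.
apply: (@leq_trans (\sum_(u in I) c)); last by rewrite sum_nat_const.
rewrite big_mkcondr; apply: leq_sum => u _; case: ifP => //.
by rewrite inE -leqNgt.
Qed.

Lemma card_linked_le :
  #|[set p : V * V | [&& p.1 \in I, p.2 \in I & linked E (pi p.1) (pi p.2)]]|
    <= 4 * c * sigma * D * #|I|.
Proof.
apply: (@leq_trans (\sum_a X a * X a)).
  have -> : \sum_a X a * X a = \sum_a #|setX [set u in I | E a (pi u)] [set u in I | E a (pi u)]|.
    by apply: eq_bigr => a _; rewrite cardsX.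
  apply: leq_trans (card_bigcup_le _ _); apply: subset_leq_card.
  apply/subsetP => -[u v]; rewrite inE /= => /and3P[uI vI /existsP[a /andP[au av]]].
  by apply/bigcupP; exists a => //; rewrite !inE uI vI au av.
pose A := [set a | 2 * c * sigma < X a].
have At : #|A| <= t.
  rewrite leqNgt; apply/negP => /ltnW/subset_of_card[B BA Bt].
  have := sum_nbr_small_le (eq_leq Bt); apply/negP; rewrite -ltnNge.
  apply: (@leq_trans ((2 * c * sigma).+1 * t)); first by rewrite ltn_pmul2r.
  rewrite -Bt mulnC -sum_nat_const; apply: leq_sum => j /(subsetP BA).
  by rewrite inE.
rewrite (bigID (mem A)) /=.
apply: (@leq_trans (sigma * D * (2 * c * sigma * t) + 2 * c * sigma * (#|I| * D))).
  apply: leq_add.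
    apply: (@leq_trans (\sum_(a in A) sigma * D * X a)).
      by apply: leq_sum => a _; rewrite leq_mul2r nbr_card_le orbT.
    by rewrite -big_distrr leq_mul2l sum_nbr_small_le ?orbT.
  apply: (@leq_trans (\sum_a 2 * c * sigma * X a)).
    rewrite big_mkcond; apply: leq_sum => a _; case: ifP => //.
    by rewrite inE -leqNgt => h; rewrite leq_mul2r h orbT.
  by rewrite -big_distrr leq_mul2l sum_nbr_le ?orbT.
rewrite cardI; lia.
Qed.

End LinkedPairs.

(** * Revealing a random graph on its open pairs *)

(** Reveal [f] off [F] first. This fixes [Y f], while the values on [F] stay uniform and
    independent, so [z] is missed on [y] or more points of [Y f] with probability at most
    [(1 - 1/#|rT|) ^ y]. *)
Lemma card_exposed_le (aT rT : finType) (F : {set aT}) (z : rT)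
    (Y : {ffun aT -> rT} -> {set aT}) y :
  (forall f g : {ffun aT -> rT}, {in ~: F, f =1 g} -> Y f = Y g) ->
  (forall f, Y f \subset F) ->
  #|[set f : {ffun aT -> rT} | (y <= #|Y f|) && [forall x in Y f, f x != z]]|
      * #|rT| ^ y <= #|rT|.-1 ^ y * #|rT| ^ #|aT|.
Proof.
move=> Yext YF; set A := [set f | _]; set R := #|rT|.
(* Resetting the values on [F] to [z] makes the fibres of [e] the classes of functions that agree
   off [F]. *)
pose e (f : {ffun aT -> rT}) := [ffun x => if x \in F then z else f x].
have Ye f : Y (e f) = Y f.
  by apply: Yext => x; rewrite inE ffunE => /negbTE ->.
have fib g : g \in e @: A ->
    #|[set f in A | e f == g]| * R ^ y <= R.-1 ^ y * R ^ #|F|.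
  move=> /imsetP[f0 f0A ->]; move: f0A; rewrite inE => /andP[Yy _].
  pose Q x := if x \in Y f0 then [set~ z] else if x \in F then [set: rT] else [set f0 x].
  have sub : [set f in A | e f == e f0] \subset
      [set f : {ffun aT -> rT} | [forall x, f x \in Q x]].
    apply/subsetP => f; rewrite !inE => /andP[/andP[_ fz] /eqP eq_e].
    have eqY : Y f = Y f0 by rewrite -Ye eq_e Ye.
    apply/forallP => x; rewrite /Q; case: ifP => [xY|_].
      by move/forall_inP: fz; rewrite eqY !inE; apply.
    case: ifP => xF; rewrite !inE //.
    by move/ffunP: eq_e => /(_ x); rewrite !ffunE xF => ->.
  apply: (leq_trans (leq_mul (subset_leq_card sub) (leqnn _))).
  rewrite card_family_prod.
  have -> : \prod_x #|Q x| = R.-1 ^ #|Y f0| * R ^ #|F :\: Y f0|.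
    rewrite -!prod_nat_const [X in _ = X * _]big_mkcond [X in _ = _ * X]big_mkcond -big_split /=.
    apply: eq_bigr => x _; rewrite /Q inE.
    case: (boolP (x \in Y f0)) => xY /=; first by rewrite cardsC1 muln1.
    by case: ifP => _; rewrite mul1n ?cardsT ?cards1.
  have le_YF := subset_leq_card (YF f0).
  rewrite cardsD (setIidPr (YF f0)).
  rewrite -{1}(subnKC Yy) expnD -!mulnA leq_mul2l; apply/orP; right.
  rewrite -expnD; apply: (@leq_trans (R ^ (#|Y f0| - y) * R ^ (#|F| - #|Y f0| + y))).
    by rewrite leq_mul2r; apply/orP; right; case: (#|Y f0| - y) => // e'; rewrite leq_exp2r // leq_pred.
  by rewrite -expnD; apply: eq_leq; congr (_ ^ _); lia.
have cardA : #|A| = \sum_(g in e @: A) #|[set f in A | e f == g]|.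
  rewrite -sum1_card (partition_big e (mem (e @: A))) /=; last first.
    by move=> f fA; apply: imset_f.
  by apply: eq_bigr => g _; rewrite -sum1_card; apply: eq_bigl => f; rewrite !inE.
have range : #|e @: A| * R ^ #|F| <= R ^ #|aT|.
  have := @card_family_le aT rT F (fun=> [set z]) 1 _.
  rewrite exp1n mul1n => /(_ (fun _ _ => eq_leq (cards1 z))).
  apply: leq_trans; rewrite leq_mul2r; apply/orP; right.
  apply: subset_leq_card; apply/subsetP => _ /imsetP[f _ ->].
  rewrite inE; apply/forall_inP => x xF; by rewrite ffunE xF inE.
rewrite cardA big_distrl /=.
apply: (@leq_trans (\sum_(g in e @: A) R.-1 ^ y * R ^ #|F|)).
  exact: leq_sum.
rewrite sum_nat_const mulnCA leq_mul2l; apply/orP; right; exact: range.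
Qed.

Section RandomGraph.
Variables (N M : nat).
Implicit Types f : {ffun 'I_N * 'I_N -> 'I_M}.

(* The value 0 encodes an edge, so a uniform f is the random graph of density
   1 / M; only the values at pairs a < b matter. *)
Definition adj f : rel 'I_N := fun a b =>
  (a < b) && (f (a, b) == 0 :> nat) || (b < a) && (f (b, a) == 0 :> nat).

Lemma adj_sym f : symmetric (adj f).
Proof. by move=> a b; rewrite /adj orbC. Qed.

Lemma adj_irr f : irreflexive (adj f).
Proof. by move=> a; rewrite /adj ltnn. Qed.

Definition adj_off (F : {set 'I_N * 'I_N}) f : rel 'I_N := fun a b =>
  [&& adj f a b, (a, b) \notin F & (b, a) \notin F].

Lemma adj_off_ext F f (g : {ffun 'I_N * 'I_N -> 'I_M}) : {in ~: F, f =1 g} -> adj_off F f =2 adj_off F g.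
Proof.
move=> fg a b; rewrite /adj_off /adj.
case: (boolP ((a, b) \in F)) => ab; first by rewrite !andbF.
case: (boolP ((b, a) \in F)) => ba; first by rewrite !andbF.
by rewrite !fg ?inE.
Qed.

Definition few_linked k f := [forall J : {set 'I_N}, (#|J| == k) ==>
  (16 * #|[set p : 'I_N * 'I_N |
     [&& p.1 \in J, p.2 \in J & linked (adj f) p.1 p.2]]| <= k * k)].

Variables (V : finType) (pi : V -> 'I_N) (O : rel V).

(** In the application [O u v] says that [u] and [v] are not linked in the other random graph, so an
    edge at an open pair survives in the blow-up. *)
Definition open_pairs (I : {set V}) : {set 'I_N * 'I_N} :=
  [set p : 'I_N * 'I_N | (p.1 < p.2) &&
    [exists u in I, exists v in I, [&& pi u == p.1, pi v == p.2 & O u v]]].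

(* Computed from the values of f off [open_pairs I] only, so that these pairs can
   be revealed afterwards. *)
Definition unlinked_open (I : {set V}) f :=
  [set p in open_pairs I | ~~ linked (adj_off (open_pairs I) f) p.1 p.2].

Definition blocked I f := [forall p in unlinked_open I f, f p != 0 :> nat].

Variable k : nat.
Hypothesis O_large : forall I : {set V}, #|I| = k ->
  16 * #|[set p : V * V | [&& p.1 \in I, p.2 \in I & ~~ O p.1 p.2]]| <= k * k.

(** As [pi] is injective on [I], at least [(k^2 - k) / 2], hence [3 k^2 / 8], pairs of [I] have
    increasing images. Pairs outside [O] and linked pairs cost at most [k^2 / 16] each. *)
Lemma card_unlinked_open_ge (I : {set V}) f : 4 <= k -> #|I| = k ->
  {in I &, injective pi} -> few_linked k f -> k * k <= 4 * #|unlinked_open I f|.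
Proof.
move=> k4 Ik inj /forallP/(_ (pi @: I)); rewrite card_in_imset // Ik eqxx /=.
set C := [set _ | _] => leC; have := O_large Ik.
set B := [set _ | _] => leB.
pose L := [set p : V * V | [&& p.1 \in I, p.2 \in I & pi p.1 < pi p.2]].
pose G := [set p : V * V | [&& p.1 \in I, p.2 \in I & pi p.2 < pi p.1]].
pose D := [set (u, u) | u in I].
have cD : #|D| <= k by rewrite -Ik leq_imset_card.
have cG : #|G| <= #|L|.
  apply: (@leq_trans #|[set (p.2, p.1) | p in L]|); last exact: leq_imset_card.
  apply: subset_leq_card; apply/subsetP => -[u v]; rewrite inE /= => /and3P[uI vI lt].
  by apply/imsetP; exists (v, u) => //; rewrite inE /= vI uI lt.
have cI : k * k <= #|L| + #|G| + #|D|.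
  rewrite -Ik -cardsX; apply: (@leq_trans #|L :|: G :|: D|); last first.
    apply: (leq_trans (leq_card_setU _ _)); rewrite leq_add2r.
    exact: leq_card_setU.
  apply: subset_leq_card; apply/subsetP => -[u v]; rewrite !inE /= => /andP[uI vI].
  rewrite uI vI /=; case: ltngtP => //= /val_inj/(inj _ _ uI vI) <-.
  by apply: imset_f.
pose S := [set (pi p.1, pi p.2) | p in L :\: B].
have cS : #|L| - #|B| <= #|S|.
  rewrite card_in_imset; first by rewrite leq_subLR -[X in X <= _](cardsID B) leq_add2r subset_leq_card ?subsetIr.
  move=> [u v] [u' v']; rewrite !inE /= => /andP[_ /and3P[uI vI _]] /andP[_ /and3P[uI' vI' _]].
  by move=> [] /(inj _ _ uI uI') -> /(inj _ _ vI vI') ->.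
have SF : S \subset open_pairs I.
  apply/subsetP => _ /imsetP[[u v] h ->]; move: h; rewrite !inE /= => /andP[nB /and3P[uI vI lt]].
  rewrite lt /=; apply/exists_inP; exists u => //; apply/exists_inP; exists v => //.
  by rewrite !eqxx /=; move: nB; rewrite uI vI /= negbK.
have cY : #|open_pairs I| <= #|unlinked_open I f| + #|C|.
  apply: leq_trans (leq_card_setU _ _); apply: subset_leq_card.
  apply/subsetP => p pF; rewrite in_setU [in X in X || _]inE pF /=.
  case: (boolP (linked _ _ _)) => //= /existsP[a /andP[a1 a2]].
  move: pF; rewrite inE => /andP[_ /exists_inP[u uI /exists_inP[v vI]]].
  move=> /and3P[/eqP p1 /eqP p2 _]; rewrite inE -p1 -p2 !imset_f //=.
  apply/existsP; exists a; rewrite p1 p2.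
  by case/and3P: a1 => -> _ _; case/and3P: a2 => -> _ _.
have k4k : 4 * k <= k * k by rewrite leq_mul2r k4 orbT.
have := subset_leq_card SF; move: (k * k) leC leB cD cG cI cS cY k4k.
move: #|C| #|B| #|D| #|G| #|L| #|S| #|open_pairs I| #|unlinked_open I f|.
clear; lia.
Qed.

(** Union bound over the at most [#|V| ^ k] sets [I], revealing the open pairs of each. *)
Lemma card_blocked_le y : 4 <= k -> 4 * y <= k * k -> 0 < M ->
  16 * (#|V| ^ k * M.-1 ^ y) <= M ^ y ->
  16 * #|[set f | few_linked k f && [exists I : {set V},
      [&& #|I| == k, dinjectiveb pi (mem I) & blocked I f]]]|
    <= M ^ (N * N).
Proof.
move=> k4 yk M0 H.
set A := [set _ | _].
have sub : A \subset \bigcup_(I in [set I : {set V} | #|I| == k])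
   [set f | (y <= #|unlinked_open I f|) && [forall x in unlinked_open I f, f x != Ordinal M0]].
  apply/subsetP => f; rewrite inE => /andP[few /existsP[I /and3P[Ik inj bl]]].
  apply/bigcupP; exists I; rewrite inE //.
  apply/andP; split; last exact: bl.
  have := card_unlinked_open_ge k4 (eqP Ik) _ few.
  move=> /(_ _)-/(_ (dinjectiveP _ _ inj)).
  lia.
have each I : #|[set f | (y <= #|unlinked_open I f|) && [forall x in unlinked_open I f, f x != Ordinal M0]]| * M ^ y
    <= M.-1 ^ y * M ^ (N * N).
  have := @card_exposed_le _ _ (open_pairs I) (Ordinal M0) (unlinked_open I) y.
  rewrite card_ord card_prod card_ord; apply.
    move=> f g fg; apply/setP => p; rewrite !inE; congr (_ && ~~ _).
    by apply: eq_existsb => a; rewrite !(adj_off_ext fg).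
  by move=> f; apply/subsetP => p; rewrite inE => /andP[].
have My : 0 < M ^ y by rewrite expn_gt0 M0.
rewrite -(@leq_pmul2r (M ^ y)) //.
apply: (@leq_trans (16 * (#|V| ^ k * (M.-1 ^ y * M ^ (N * N))))); last first.
  by rewrite !mulnA -!mulnA mulnA mulnA mulnC leq_mul2l -mulnA H orbT.
rewrite -mulnA leq_mul2l /=.
apply: (leq_trans (leq_mul (subset_leq_card sub) (leqnn _))).
apply: (leq_trans (leq_mul (card_bigcup_le _ _) (leqnn _))).
rewrite big_distrl /=.
apply: (@leq_trans (\sum_(I in [set I : {set V} | #|I| == k]) M.-1 ^ y * M ^ (N * N))).
  exact: leq_sum.
rewrite sum_nat_const leq_mul2r; apply/orP; right.
by rewrite card_draws bin_le_expn.
Qed.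

End RandomGraph.

(** * Maximal triangle-free subgraphs *)

(** Take an inclusion-maximal symmetric triangle-free set of pairs: an edge of [E] outside it would
    close a triangle, whose third vertex links its ends. *)
Lemma exists_maximal_triangle_free (T : finType) (E : rel T) :
  symmetric E -> irreflexive E ->
  exists H : rel T, [/\ symmetric H, subrel H E,
    forall a b c, H a b -> H b c -> H a c -> False &
    forall a b, E a b -> ~~ H a b -> linked H a b].
Proof.
move=> Es Ei.
pose P (S : {set T * T}) := [forall a, forall b, ((a, b) \in S) ==> E a b && ((b, a) \in S)] &&
  [forall a, forall b, forall c, ~~ [&& (a, b) \in S, (b, c) \in S & (a, c) \in S]].
have P0 : P set0.
  by apply/andP; split; do 2![apply/forallP => ?]; try apply/forallP => ?; rewrite !inE.
have [S /maxsetP[PS Smax] _] := maxset_exists P0.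
case/andP: (PS) => /forallP S1 /forallP S2.
have SE a b : (a, b) \in S -> E a b.
  by move=> ab; move/forallP: (S1 a) => /(_ b); rewrite ab => /andP[].
have Ss a b : (a, b) \in S -> (b, a) \in S.
  by move=> ab; move/forallP: (S1 a) => /(_ b); rewrite ab => /andP[].
have St a b c : (a, b) \in S -> (b, c) \in S -> (a, c) \in S -> False.
  by move=> ab bc ac; move/forallP: (S2 a) => /(_ b)/forallP/(_ c); rewrite ab bc ac.
exists (fun a b => (a, b) \in S); split => //.
  by move=> a b; apply/idP/idP; apply: Ss.
move=> a b Eab abS; case: (boolP (linked _ a b)) => // /existsPn nl.
have nlS c : (c, a) \in S -> (c, b) \in S -> False.
  by move=> ca cb; have := nl c; rewrite ca cb.
have ab : a <> b by move=> eab; rewrite eab Ei in Eab.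
have ns c : (c, c) \in S -> False by move/SE; rewrite Ei.
pose S' := S :|: [set (a, b); (b, a)].
suff PS' : P S'.
  have := Smax _ PS' (subsetUl _ _) => /setP/(_ (a, b)).
  by rewrite !inE eqxx orbT (negbTE abS).
have inS' x y : (x, y) \in S' -> [\/ (x, y) \in S, x = a /\ y = b | x = b /\ y = a].
  rewrite !inE !xpair_eqE => /or3P[?|/andP[/eqP ? /eqP ?]|/andP[/eqP ? /eqP ?]];
  by [constructor 1 | constructor 2 | constructor 3].
apply/andP; split.
  apply/forallP => x; apply/forallP => y; apply/implyP => /inS'[xy|[-> ->]|[-> ->]].
  - by rewrite (SE _ _ xy) inE (Ss _ _ xy).
  - by rewrite Eab !inE eqxx !orbT.
  - by rewrite Es Eab !inE eqxx !orbT.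
apply/forallP => x; apply/forallP => y; apply/forallP => z.
apply/negP => /and3P[/inS' xy /inS' yz /inS' xz].
case: xy yz xz => [xy|[? ?]|[? ?]] [yz|[? ?]|[? ?]] [xz|[? ?]|[? ?]]; subst;
  eauto 6.
Qed.

(** * Degrees and local sparsity of a random graph *)

Lemma card_setX_dep (T1 T2 : finType) (A : {set T1}) (B : {set T2})
    (R : T1 -> T2 -> bool) :
  #|[set p in setX A B | R p.1 p.2]| = \sum_(a in A) #|[set b in B | R a b]|.
Proof.
under eq_bigr do rewrite -sum1dep_card.
rewrite pair_big_dep -sum1dep_card; apply: eq_bigl => p.
by rewrite !inE andbA.
Qed.

Section GoodGraph.
Variables (N M t c d : nat).
Implicit Types f : {ffun 'I_N * 'I_N -> 'I_M}.

Definition is_edge (z : 'I_M) : bool := z == 0 :> nat.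
Definition edge_values : {set 'I_M} := [set z | is_edge z].

Lemma card_edge_values : #|edge_values| <= 1.
Proof.
apply/card_le1_eqP => z1 z2; rewrite !inE => /eqP e1 /eqP e2.
by apply: val_inj; rewrite /= e1 e2.
Qed.

(** An edge is read at its increasing pair only, so the neighbours of [a] are spread over row [a]
    and column [a]. *)
Definition dense_row f := [exists a,
  d <= #|[set p in [set p : 'I_N * 'I_N | p.1 == a] | f p \in edge_values]|].
Definition dense_col f := [exists a,
  d <= #|[set p in [set p : 'I_N * 'I_N | p.2 == a] | f p \in edge_values]|].
(* Boxes are indexed by functions, whose images are the sets of size at most t. *)
Definition dense_box f :=
  [exists gh : {ffun 'I_t -> 'I_N} * {ffun 'I_t -> 'I_N},
    c * t <= #|[set p in setX (gh.1 @: setT) (gh.2 @: setT) | f p \in edge_values]|].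
Definition sparse_graph f := ~~ [|| dense_row f, dense_col f | dense_box f].

(** On average a row or column has [N / M] edge values, and [d] is at least 8 times that; a box has
    at most [t^2 / M], and [c * t] is at least [4 * r] times that. The powers of 2 and [r] beat the
    number of rows, columns and boxes. *)
Lemma card_dense_graph_le r : 0 < M -> 0 < d -> 0 < t -> 0 < c ->
  16 * N <= 2 ^ d -> 8 * N <= d * M ->
  16 * N ^ (2 * t) <= r ^ (c * t) -> r * (4 * t) <= c * M ->
  16 * #|[set f | ~~ sparse_graph f]| <= 3 * M ^ (N * N).
Proof.
move=> M0 d0 t0 c0 h1 h2 h3 h4.
have E : M ^ (N * N) = #|'I_M| ^ #|{: 'I_N * 'I_N}| by rewrite card_prod !card_ord.
have r1 : 16 * #|[set f | dense_row f]| <= M ^ (N * N).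
  rewrite E; apply: (@card_many_hits_small _ _ _ _ (fun _ _ => edge_values) N 1 d 2);
    rewrite ?card_ord //; last by rewrite muln1; lia.
  - move=> a; have -> : [set p : 'I_N * 'I_N | p.1 == a] = setX [set a] setT.
      by apply/setP => p; rewrite !inE andbT.
    by rewrite cardsX cards1 cardsT card_ord mul1n.
  by move=> _ _; apply: card_edge_values.
have r2 : 16 * #|[set f | dense_col f]| <= M ^ (N * N).
  rewrite E; apply: (@card_many_hits_small _ _ _ _ (fun _ _ => edge_values) N 1 d 2);
    rewrite ?card_ord //; last by rewrite muln1; lia.
  - move=> a; have -> : [set p : 'I_N * 'I_N | p.2 == a] = setX setT [set a].
      by apply/setP => p; rewrite !inE.
    by rewrite cardsX cards1 cardsT card_ord muln1.
  by move=> _ _; apply: card_edge_values.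
have r3 : 16 * #|[set f | dense_box f]| <= M ^ (N * N).
  rewrite E; apply: (@card_many_hits_small _ _ _ _ (fun _ _ => edge_values) (t * t) 1 (c * t) r);
    rewrite ?card_ord //.
  - move=> gh; rewrite cardsX; apply: leq_mul;
    by apply: leq_trans (leq_imset_card _ _) _; rewrite cardsT card_ord.
  - by move=> _ _; apply: card_edge_values.
  - by rewrite muln_gt0 c0.
  - by rewrite card_prod !card_ffun !card_ord -expnD addnn -mul2n.
  - by rewrite muln1; move: (leq_mul h4 (leqnn t)); nia.
have sub : [set f | ~~ sparse_graph f] \subset
    [set f | dense_row f] :|: [set f | dense_col f] :|: [set f | dense_box f].
  by apply/subsetP => f; rewrite !inE negbK orbA.
have := subset_leq_card sub.
have := leq_of_leqif (leq_card_setU ([set f | dense_row f] :|: [set f | dense_col f]) [set f | dense_box f]).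
have := leq_of_leqif (leq_card_setU [set f | dense_row f] [set f | dense_col f]).
by move: r1 r2 r3; lia.
Qed.

Lemma subset_codom_of_card (T : finType) (x0 : T) (A : {set T}) k : #|A| <= k ->
  exists g : {ffun 'I_k -> T}, A \subset g @: setT.
Proof.
(* Positions past the end of [enum A] take the default [x0], so the image contains [A] but may be
   larger. *)
move=> Ak; exists [ffun i : 'I_k => nth x0 (enum A) i].
apply/subsetP => x; rewrite -mem_enum => xA.
have lt : index x (enum A) < k.
  by apply: leq_trans Ak; rewrite cardE index_mem.
by apply/imsetP; exists (Ordinal lt) => //; rewrite ffunE /= nth_index.
Qed.

Section Sparse.
Variable f : {ffun 'I_N * 'I_N -> 'I_M}.
Hypothesis fs : sparse_graph f.

Lemma adj_degree_le a : #|[set b | adj f a b]| <= 2 * d.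
Proof.
move: fs; rewrite /sparse_graph !negb_or => /and3P[/existsPn r /existsPn cl _].
have := r a; have := cl a; rewrite -!ltnNge.
set C := [set _ in _ | _]; set R := [set _ in _ | _] => leC leR.
apply: (@leq_trans #|[set p.2 | p in R] :|: [set p.1 | p in C]|).
  apply: subset_leq_card; apply/subsetP => b; rewrite !inE => /orP[] /andP[_ h].
    by apply/orP; left; apply/imsetP; exists (a, b); rewrite ?inE ?eqxx.
  by apply/orP; right; apply/imsetP; exists (b, a); rewrite ?inE ?eqxx.
apply: (leq_trans (leq_card_setU _ _)).
rewrite mul2n -addnn.
by apply: leq_add; apply: leq_trans (leq_imset_card _ _) _; apply: ltnW.
Qed.

Lemma adj_locally_sparse : locally_sparse (adj f) t (2 * c).
Proof.
have box (A B : {set 'I_N}) : #|A| <= t -> #|B| <= t ->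
    #|[set p in setX A B | f (p.1, p.2) \in edge_values]| <= c * t.
  have [->|[x0 _]] := set_0Vmem A.
    move=> _ _; rewrite (_ : [set p in _ | _] = set0) ?cards0 //.
    by apply/setP => p; rewrite !inE.
  move=> At Bt; have [g Ag] := subset_codom_of_card x0 At.
  have [h Bh] := subset_codom_of_card x0 Bt.
  move: fs; rewrite /sparse_graph !negb_or => /and3P[_ _ /existsPn/(_ (g, h))].
  rewrite -ltnNge => /ltnW; apply: leq_trans; apply: subset_leq_card.
  apply/subsetP => -[a b]; rewrite !inE => /andP[/andP[pA pB] ->].
  by rewrite (subsetP Ag) ?(subsetP Bh).
move=> A B At Bt.
apply: (@leq_trans (\sum_(a in A) (#|[set b in B | f (a, b) \in edge_values]|
   + #|[set b in B | f (b, a) \in edge_values]|))).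
  apply: leq_sum => a _; apply: leq_trans (leq_card_setU _ _).
  apply: subset_leq_card; apply/subsetP => b; rewrite !inE /is_edge => /andP[-> /=].
  by case/orP => /andP[_ ->]; rewrite ?orbT.
rewrite big_split mul2n -addnn mulnDl; apply: leq_add.
  by rewrite -(card_setX_dep A B (fun a b => f (a, b) \in edge_values)) box.
rewrite sum_card_exchange.
by rewrite -(card_setX_dep B A (fun b a => f (b, a) \in edge_values)) box.
Qed.

Lemma few_linked_pairs (V : finType) (pi : V -> 'I_N) sigma (I : {set V}) :
  (forall b, #|[set v | pi v == b]| <= sigma) -> 0 < t -> 256 * c * d <= t ->
  #|I| = sigma * t ->
  16 * #|[set p : V * V | [&& p.1 \in I, p.2 \in I & linked (adj f) (pi p.1) (pi p.2)]]|
    <= #|I| * #|I|.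
Proof.
move=> fib t0 cdt cI.
have := card_linked_le (adj_sym f) adj_degree_le adj_locally_sparse fib cI t0.
set L := #|_| => leL; apply: (leq_trans (leq_mul (leqnn 16) leL)).
(* The constant 256 is [16 * 4 * 2 * 2], with a factor 2 from the degree bound and another from
   local sparsity. *)
rewrite mulnA leq_mul2r; apply/orP; right; rewrite cI; nia.
Qed.

Lemma sparse_few_linked sigma : 0 < sigma -> 0 < t -> 256 * c * d <= t ->
  few_linked (sigma * t) f.
Proof.
move=> s0 t0 cdt; apply/forallP => J; apply/implyP => /eqP cJ.
have := @few_linked_pairs 'I_N id sigma J _ t0 cdt cJ; rewrite cJ; apply.
move=> b; apply: leq_trans s0; rewrite (_ : [set _ | _] = [set b]) ?cards1 //.
by apply/setP => v; rewrite !inE.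
Qed.

End Sparse.
End GoodGraph.

(** * The random second projection *)

(** A uniform [rho] works: a fibre has [s] points on average, and a box [A], [B] receives at most
    [s k^2 / N]. By the second property, a set of [8 * k] vertices has at least [k] images under the
    first projection or under [rho]. *)
Lemma exists_spread_map N s k sigma : 0 < N -> 0 < sigma -> 0 < k ->
  16 * N <= 2 ^ sigma -> 8 * s <= sigma -> forall r,
  16 * N ^ (2 * k) <= r ^ (8 * k) -> r * (s * k) <= 2 * N ->
  exists rho : 'I_N * 'I_s -> 'I_N,
    (forall b, #|[set v | rho v == b]| <= sigma) /\
    (forall A B : {set 'I_N}, #|A| <= k -> #|B| <= k ->
      #|[set v | (v.1 \in A) && (rho v \in B)]| < 8 * k).
Proof.
move=> N0 s0 k0 h1 h2 r h3 h4.
pose bad1 (f : {ffun 'I_N * 'I_s -> 'I_N}) :=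
  [exists b, sigma <= #|[set x in [set: 'I_N * 'I_s] | f x \in [set b]]|].
pose bad2 (f : {ffun 'I_N * 'I_s -> 'I_N}) :=
  [exists gh : {ffun 'I_k -> 'I_N} * {ffun 'I_k -> 'I_N},
    8 * k <= #|[set x in setX (gh.1 @: setT) [set: 'I_s] | f x \in gh.2 @: setT]|].
have im (g : {ffun 'I_k -> 'I_N}) : #|g @: setT| <= k.
  by apply: leq_trans (leq_imset_card _ _) _; rewrite cardsT card_ord.
have E : N ^ (N * s) = #|'I_N| ^ #|{: 'I_N * 'I_s}| by rewrite card_prod !card_ord.
have r1 : 16 * #|[set f | bad1 f]| <= N ^ (N * s).
  rewrite E; apply: (@card_many_hits_small _ _ _ (fun=> setT) (fun b _ => [set b]) (N * s) 1 sigma 2);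
    rewrite ?card_ord //.
  - by move=> _; rewrite cardsT card_prod !card_ord.
  - by move=> b _; rewrite cards1.
  - by move: (leq_mul h2 (leqnn N)); nia.
have r2 : 16 * #|[set f | bad2 f]| <= N ^ (N * s).
  rewrite E; apply: (@card_many_hits_small _ _ _ (fun gh : {ffun 'I_k -> 'I_N} * {ffun 'I_k -> 'I_N} => setX (gh.1 @: setT) [set: 'I_s]) (fun gh _ => gh.2 @: setT) (k * s) k (8 * k) r);
    rewrite ?card_ord //.
  - by move=> gh; rewrite cardsX cardsT card_ord leq_mul2r im orbT.
  - by rewrite muln_gt0.
  - by rewrite card_prod !card_ffun !card_ord -expnD addnn -mul2n.
  - by move: (leq_mul h4 (leqnn k)); nia.
have W0 : 0 < N ^ (N * s) by rewrite expn_gt0 N0.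
have [f] : exists f, f \notin [set f | bad1 f] :|: [set f | bad2 f].
  apply/existsP; rewrite -negb_forall; apply/negP => /forallP all.
  have : [set: {ffun 'I_N * 'I_s -> 'I_N}] \subset [set f | bad1 f] :|: [set f | bad2 f].
    by apply/subsetP => f _; apply: all.
  move/subset_leq_card; rewrite cardsT card_ffun card_prod !card_ord => h.
  have h' := leq_trans h (leq_of_leqif (leq_card_setU _ _)).
  have : 16 * N ^ (N * s) <= N ^ (N * s) + N ^ (N * s).
    by apply: leq_trans (leq_mul (leqnn 16) h') _; rewrite mulnDr leq_add.
  by lia.
rewrite !inE negb_or => /andP[/existsPn b1 /existsPn b2].
exists f; split.
  move=> b; have := b1 b; rewrite -ltnNge => /ltnW; apply: leq_trans.
  by apply: subset_leq_card; apply/subsetP => v; rewrite !inE.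
move=> A B Ak Bk; pose x0 : 'I_N := Ordinal N0.
have [g Ag] := subset_codom_of_card x0 Ak.
have [h Bh] := subset_codom_of_card x0 Bk.
have := b2 (g, h); rewrite -ltnNge; apply: leq_ltn_trans.
apply: subset_leq_card; apply/subsetP => v; rewrite !inE => /andP[vA vB].
by rewrite (subsetP Ag) ?(subsetP Bh).
Qed.

(** * Union of the two blow-ups *)

Section Assembly.
Variables (N s M t c d sigma y : nat).
Let k := sigma * t.
Hypotheses (N_gt0 : 0 < N) (M_gt0 : 0 < M) (t_gt0 : 0 < t) (c_gt0 : 0 < c).
Hypotheses (d_gt0 : 0 < d) (sigma_gt0 : 0 < sigma) (k_ge4 : 4 <= k).
Hypotheses (s_sigma : 8 * s <= sigma) (N_sigma : 16 * N <= 2 ^ sigma).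
Hypotheses (N_d : 16 * N <= 2 ^ d) (NdM : 8 * N <= d * M) (cdt : 256 * c * d <= t).
Variables (r1 r2 : nat).
Hypotheses (N_r1 : 16 * N ^ (2 * t) <= r1 ^ (c * t)) (r1tM : r1 * (4 * t) <= c * M).
Hypotheses (N_r2 : 16 * N ^ (2 * k) <= r2 ^ (8 * k)) (r2N : r2 * (s * k) <= 2 * N).
Hypotheses (yk : 4 * y <= k * k) (My : 16 * ((N * s) ^ k * M.-1 ^ y) <= M ^ y).

Let V : finType := ('I_N * 'I_s)%type.
Let graph := {ffun 'I_N * 'I_N -> 'I_M}.

(** The other graph [f'] decides which pairs are open and is held fixed while [f] varies; the event
    is used once in each direction. *)
Let has_blocked (pi pi' : V -> 'I_N) (f' f : graph) :=
  few_linked k f && [exists I : {set V},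
    [&& #|I| == k, dinjectiveb pi (mem I) &
      blocked pi (fun u v => ~~ linked (adj f') (pi' u) (pi' v)) I f]].

Let card_has_blocked (pi pi' : V -> 'I_N) f' :
  (forall b, #|[set v | pi' v == b]| <= sigma) -> sparse_graph t c d f' ->
  16 * #|[set f | has_blocked pi pi' f' f]| <= M ^ (N * N).
Proof.
move=> fib fs; rewrite /has_blocked. apply: (card_blocked_le _ _ k_ge4 yk M_gt0); last first.
  by rewrite card_prod !card_ord.
move=> I cI; have := few_linked_pairs fs fib t_gt0 cdt cI; rewrite cI.
congr (16 * _ <= _); apply: eq_card => p; rewrite !inE negbK //.
Qed.

(** Count the pairs [(f1, f2)]: at most 3/16 fail sparsity in each coordinate, and for each sparse
    choice of one graph at most 1/16 of the others are blocked. Together this is at most 8/16. *)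
Lemma exists_good_pair (pi1 pi2 : V -> 'I_N) :
  (forall b, #|[set v | pi1 v == b]| <= sigma) ->
  (forall b, #|[set v | pi2 v == b]| <= sigma) ->
  exists f1 f2 : graph, [/\ sparse_graph t c d f1, sparse_graph t c d f2,
    ~~ has_blocked pi1 pi2 f2 f1 & ~~ has_blocked pi2 pi1 f1 f2].
Proof.
move=> fib1 fib2; set W := M ^ (N * N).
have cW : #|{: graph}| = W by rewrite card_ffun card_prod !card_ord.
pose R := [set f : graph | ~~ sparse_graph t c d f].
have cR : 16 * #|R| <= 3 * W by apply: (@card_dense_graph_le N M t c d r1).
pose B1 := \bigcup_(f2 in ~: R) setX [set f1 | has_blocked pi1 pi2 f2 f1] [set f2].
pose B2 := \bigcup_(f1 in ~: R) setX [set f1] [set f2 | has_blocked pi2 pi1 f1 f2].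
have cB1 : 16 * #|B1| <= W * W.
  apply: (leq_trans (leq_mul (leqnn 16) (card_bigcup_le _ _))).
  rewrite big_distrr -[X in X * _]cW -sum_nat_const big_mkcond /=.
  apply: leq_sum => f _; case: ifP => //; rewrite !inE negbK => fs.
  by rewrite cardsX cards1 muln1; apply: card_has_blocked.
have cB2 : 16 * #|B2| <= W * W.
  apply: (leq_trans (leq_mul (leqnn 16) (card_bigcup_le _ _))).
  rewrite big_distrr -[X in X * _]cW -sum_nat_const big_mkcond /=.
  apply: leq_sum => f _; case: ifP => //; rewrite !inE negbK => fs.
  by rewrite cardsX cards1 mul1n; apply: card_has_blocked.
have W0 : 0 < W * W by rewrite muln_gt0 !expn_gt0 M_gt0.
have [p] : exists p, p \notin setX R setT :|: setX setT R :|: (B1 :|: B2).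
  apply/existsP; rewrite -negb_forall; apply/negP => /forallP all.
  have : [set: graph * graph] \subset setX R setT :|: setX setT R :|: (B1 :|: B2).
    by apply/subsetP => f _; apply: all.
  move/subset_leq_card; rewrite cardsT card_prod cW => h.
  suff : 16 * (W * W) <= 3 * (W * W) + 3 * (W * W) + (W * W + W * W) by lia.
  apply: (leq_trans (leq_mul (leqnn 16) h)).
  apply: (leq_trans (leq_mul (leqnn 16) (leq_of_leqif (leq_card_setU _ _)))).
  rewrite mulnDr; apply: leq_add.
    apply: (leq_trans (leq_mul (leqnn 16) (leq_of_leqif (leq_card_setU _ _)))).
    rewrite mulnDr !cardsX cardsT cW; apply: leq_add.
      by rewrite !mulnA leq_mul2r cR orbT.
    by rewrite mulnCA [3 * _]mulnCA leq_mul2l cR orbT.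
  apply: (leq_trans (leq_mul (leqnn 16) (leq_of_leqif (leq_card_setU _ _)))).
  by rewrite mulnDr leq_add.
case: p => f1 f2; rewrite !in_setU !in_setX !inE !andbT !negb_or !negbK /=.
move=> /andP[/andP[s1 s2] /andP[n1 n2]]; exists f1, f2; split => //.
  apply: contra n1 => bl; apply/bigcupP; exists f2; first by rewrite !inE negbK.
  by rewrite in_setX !inE eqxx bl.
apply: contra n2 => bl; apply/bigcupP; exists f1; first by rewrite !inE negbK.
by rewrite in_setX !inE eqxx bl.
Qed.

(** Some unlinked open pair is an edge of [f]. If [H] misses it, maximality gives a common
    [H]-neighbour of its ends, and one of the two edges used is itself an open pair, as otherwise
    the pair would be linked off the open pairs. Either way [H] has an edge at an open pair. *)
Let blocked_sub (pi pi' : V -> 'I_N) (f' f : graph) (H : rel 'I_N) (I : {set V}) :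
  symmetric H -> subrel H (adj f) ->
  (forall a b, adj f a b -> ~~ H a b -> linked H a b) ->
  sparse_graph t c d f -> ~~ has_blocked pi pi' f' f ->
  #|I| = k -> {in I &, injective pi} ->
  exists u v, [/\ u \in I, v \in I, H (pi u) (pi v) &
    ~~ linked (adj f') (pi' u) (pi' v)].
Proof.
move=> Hs HE Hmax fs; rewrite negb_and (sparse_few_linked fs) //=.
move=> /existsPn/(_ I) nb cI /dinjectiveP inj; move: nb.
rewrite cI eqxx /= inj /= => /forallPn[p]; rewrite negb_imply negbK => /andP[].
rewrite inE => /andP[pF nl] fp; set O := (fun _ => _) in pF nl.
have found q : q \in open_pairs pi O I -> H q.1 q.2 ->
    exists u v, [/\ u \in I, v \in I, H (pi u) (pi v) &
      ~~ linked (adj f') (pi' u) (pi' v)].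
  rewrite inE => /andP[_ /exists_inP[u uI /exists_inP[v vI /and3P[/eqP pu /eqP pv Ouv]]]].
  by rewrite -pu -pv; exists u, v.
have Ep : adj f p.1 p.2.
  move: pF; rewrite inE => /andP[lt _]; apply/orP; left; rewrite lt.
  by rewrite -surjective_pairing.
case: (boolP (H p.1 p.2)) => [|nH]; first exact: found.
have /existsP[a /andP[a1 a2]] := Hmax _ _ Ep nH.
have off b : H a b -> ~~ adj_off (open_pairs pi O I) f a b ->
    exists u v, [/\ u \in I, v \in I, H (pi u) (pi v) &
      ~~ linked (adj f') (pi' u) (pi' v)].
  move=> Hab; rewrite /adj_off (HE _ _ Hab) /= negb_and !negbK => /orP[] /found.
    by apply.
  by apply; rewrite Hs.
have := nl; rewrite negb_exists => /forallP/(_ a); rewrite negb_and => /orP[].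
  exact: off.
exact: off.
Qed.

Lemma exists_triangle_free_graph : exists G : rel V,
  [/\ symmetric G, irreflexive G,
    forall u v w, G u v -> G v w -> G u w -> False &
    forall I : {set V}, 8 * k <= #|I| -> exists u v, [/\ u \in I, v \in I & G u v]].
Proof.
have k_gt0 : 0 < k by apply: leq_trans k_ge4.
have [rho [fib2 small]] :=
  exists_spread_map N_gt0 sigma_gt0 k_gt0 N_sigma s_sigma N_r2 r2N.
have fib1 b : #|[set v : V | v.1 == b]| <= sigma.
  rewrite (_ : [set v | _] = setX [set b] setT); last first.
    by apply/setP => v; rewrite !inE andbT.
  by rewrite cardsX cards1 cardsT card_ord mul1n; apply: leq_trans s_sigma; lia.
have [f1 [f2 [s1 s2 b1 b2]]] := exists_good_pair fib1 fib2.
have [H1 [H1s H1E H1t H1m]] := exists_maximal_triangle_free (adj_sym f1) (adj_irr f1).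
have [H2 [H2s H2E H2t H2m]] := exists_maximal_triangle_free (adj_sym f2) (adj_irr f2).
pose l1 (u v : V) := linked (adj f1) u.1 v.1.
pose l2 (u v : V) := linked (adj f2) (rho u) (rho v).
(* Keeping only unlinked edges of the other kind excludes the triangles with
   edges of both kinds. *)
pose G1 (u v : V) := H1 u.1 v.1 && ~~ l2 u v.
pose G2 (u v : V) := H2 (rho u) (rho v) && ~~ l1 u v.
have linkS (T : finType) (E : rel T) : symmetric (linked E).
  by move=> u v; apply: eq_existsb => a; rewrite andbC.
have G1s : symmetric G1 by move=> u v; rewrite /G1 /l2 H1s linkS.
have G2s : symmetric G2 by move=> u v; rewrite /G2 /l1 H2s linkS.
have t112 u v w : G1 u w -> G1 w v -> G2 u v -> False.
  move=> /andP[uw _] /andP[wv _] /andP[_ /existsPn/(_ w.1)].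
  by rewrite adj_sym (H1E _ _ uw) (H1E _ _ wv).
have t221 u v w : G2 u w -> G2 w v -> G1 u v -> False.
  move=> /andP[uw _] /andP[wv _] /andP[_ /existsPn/(_ (rho w))].
  by rewrite adj_sym (H2E _ _ uw) (H2E _ _ wv).
exists (fun u v => G1 u v || G2 u v); split.
- by move=> u v /=; congr (_ || _); [exact: G1s | exact: G2s].
- move=> u; apply/negP => /orP[] /andP[].
    by move/H1E; rewrite adj_irr.
  by move/H2E; rewrite adj_irr.
- move=> u v w /orP[] uv /orP[] vw /orP[] uw.
  + by case/andP: uv => uv _; case/andP: vw => vw _; case/andP: uw => uw _; apply: H1t uv vw uw.
  + exact: t112 uv vw uw.
  + by apply: (t112 v w u); rewrite // G1s.
  + by apply: (t221 u v w); rewrite // G2s.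
  + by apply: (t112 u v w); rewrite // G1s.
  + by apply: (t221 v w u); rewrite // G2s.
  + exact: t221 uv vw uw.
  + by case/andP: uv => uv _; case/andP: vw => vw _; case/andP: uw => uw _; apply: H2t uv vw uw.
move=> I cI.
(* Choose one point of [I] above each of [k] points of the image. *)
have transversal (pi : V -> 'I_N) : k <= #|pi @: I| ->
    exists J : {set V}, [/\ J \subset I, #|J| = k & {in J &, injective pi}].
  move=> /subset_of_card[B BI cB].
  have pre b : exists v, (b \in B) ==> ((v \in I) && (pi v == b)).
    case: (boolP (b \in B)) => [/(subsetP BI)/imsetP[v vI ->]|_].
      by exists v; rewrite vI eqxx.
    have /card_gt0P[v _] : 0 < #|I| by apply: leq_trans cI; lia.
    by exists v.
  have [g gP] := fin_all_exists pre.
  have gB b : b \in B -> (g b \in I) /\ pi (g b) = b.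
    by move=> bB; have := gP b; rewrite bB => /andP[? /eqP].
  exists (g @: B); split.
  - by apply/subsetP => _ /imsetP[b /gB[gI _] ->].
  - rewrite card_in_imset //; apply: (can_in_inj (g := pi)) => b.
    by move=> /gB[].
  move=> _ _ /imsetP[a /gB[_ ea] ->] /imsetP[b /gB[_ eb] ->].
  by rewrite ea eb => ->.
case: (leqP k #|[set v.1 | v in I]|) => [/transversal[J [JI cJ inj]]|lt1].
  have [u [v [uJ vJ Huv nl]]] := blocked_sub H1s H1E H1m s1 b1 cJ inj.
  by exists u, v; rewrite !(subsetP JI) //; split => //; rewrite /G1 Huv nl.
case: (leqP k #|rho @: I|) => [/transversal[J [JI cJ inj]]|lt2].
  have [u [v [uJ vJ Huv nl]]] := blocked_sub H2s H2E H2m s2 b2 cJ inj.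
  by exists u, v; rewrite !(subsetP JI) //; split => //; rewrite /G2 Huv nl orbT.
have := small _ _ (ltnW lt1) (ltnW lt2).
rewrite ltnNge => /negP[]; apply: (leq_trans cI); apply: subset_leq_card.
by apply/subsetP => v vI; rewrite inE !imset_f.
Qed.

End Assembly.

(** * Choice of parameters for the triangle-free graph *)

(** Taking a 32nd power as the order and a square [l * l] as a bound for [log z] keeps the
    parameters integral. The factor 64 is 8 from [sigma] times 8 from the spread of [rho]. *)
Lemma exists_ramsey_graph K z l : 256 * 64 * 16 <= K -> 0 < l ->
  z <= 2 ^ (l * l) -> K * (l * l) <= z ->
  exists (V : finType) (G : rel V), #|V| = z ^ 32 /\
  [/\ symmetric G, irreflexive G,
    forall u v w, G u v -> G v w -> G u w -> False &
    forall I : {set V}, 64 * K * (z ^ 16 * l) <= #|I| ->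
      exists u v, [/\ u \in I, v \in I & G u v]].
Proof.
move=> K_ge l0 z_le Kl.
have ll : 0 < l * l by rewrite muln_gt0 l0.
have Kz : K <= z by apply: leq_trans Kl; rewrite leq_pmulr.
have z0 : 0 < z by lia.
have l_le : l <= l * l by rewrite leq_pmulr.
have llz : l * l <= z by apply: leq_trans Kl; rewrite leq_pmull //; lia.
have z34 : 34 * (l * l) <= z by apply: leq_trans Kl; rewrite leq_mul2r; apply/orP; right; lia.
have zp n : 0 < z ^ n by rewrite expn_gt0 z0.
have lz16 : l <= z ^ 16.
  by rewrite (leq_trans l_le) // (leq_trans llz) // -[X in X <= _]expn1 leq_pexp2l.
(* With s = z ^ 2, N = z ^ 30 and n = N * s, both the degrees in the blow-ups and
   the size k of a transversal are of order z ^ 16 * l, the square root of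
   n * log n; the constant K makes k dominate these degrees. *)
pose M := z ^ 16 %/ l; pose t := K * (z ^ 14 * l); pose sigma := 8 * z ^ 2.
pose d := 16 * (z ^ 14 * l); pose k := sigma * t.
have M0 : 0 < M by rewrite divn_gt0.
have Ml : M * l <= z ^ 16 by apply: leq_trunc_div.
(* Rounding the quotient down loses at most a factor 2, since [l <= M * l]. *)
have lM : z ^ 16 <= 2 * (M * l).
  have := ltn_ceil (z ^ 16) l0; rewrite -/M mulSn; have : l <= M * l by rewrite leq_pmull.
  by lia.
have K0 : 0 < K by lia.
have t0 : 0 < t by rewrite /t muln_gt0 K0 muln_gt0 zp.
have s0 : 0 < sigma by rewrite /sigma muln_gt0 zp.
have kE : k = 8 * K * (z ^ 16 * l).
  rewrite /k /sigma /t (_ : z ^ 16 = z ^ 2 * z ^ 14); last by rewrite -expnD.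
  by rewrite !mulnA; lia.
have k4 : 4 <= k.
  have zl : 0 < z ^ 16 * l by rewrite muln_gt0 zp.
  rewrite kE; apply: (@leq_trans (8 * K)); first by lia.
  by rewrite leq_pmulr.

have k_gt0 : 0 < k by rewrite /k muln_gt0 s0.
have z_exp n : z ^ n <= 2 ^ (l * l * n).
  by rewrite expnM; case: n => // n; rewrite leq_exp2r.
have N_two : 16 * z ^ 30 <= 2 ^ (4 + 30 * (l * l)).
  by rewrite expnD leq_mul // mulnC.
have e1 : 4 + 30 * (l * l) <= 8 * z ^ 2.
  by have := leq_mul llz (leqnn z); rewrite expnS expn1; nia.
have e2 : 4 + 30 * (l * l) <= d.
  rewrite /d; have : z <= z ^ 14 by rewrite -[X in X <= _]expn1 leq_pexp2l.
  have : z ^ 14 <= z ^ 14 * l by rewrite leq_pmulr.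
  by lia.
have z16 : 16 <= z by lia.
(* The spare factor [z ^ (4 * n)] absorbs 16. This serves both the boxes, with [r1 = z], and the
   spread of [rho], with [r2 = z ^ 8]. *)
have big n : 0 < n -> 16 * (z ^ 30) ^ (2 * n) <= z ^ (64 * n).
  move=> n0; rewrite -expnM (_ : 64 * n = 4 * n + 30 * (2 * n)); last by lia.
  rewrite expnD leq_mul2r; apply/orP; right; apply: (leq_trans z16).
  by rewrite -[X in X <= _]expn1 leq_pexp2l //; lia.
have r1tM : z * (4 * t) <= 64 * M.
  rewrite -(leq_pmul2r l0) -mulnA; apply: (@leq_trans (32 * z ^ 16)); last by lia.
  rewrite (_ : z ^ 16 = z * (z ^ 14 * z)); last by rewrite -expnSr -expnS.
  rewrite [32 * _]mulnCA leq_mul2l; apply/orP; right; rewrite /t.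
  rewrite (_ : _ * l = 4 * (z ^ 14 * (K * (l * l)))); last by lia.
  have : z ^ 14 * (K * (l * l)) <= z ^ 14 * z by rewrite leq_mul2l Kl orbT.
  by lia.
have r2N : z ^ 8 * (z ^ 2 * k) <= 2 * z ^ 30.
  rewrite (_ : z ^ 30 = z ^ 8 * (z ^ 2 * (z ^ 16 * z ^ 4))); last by rewrite -!expnD.
  rewrite [2 * _]mulnCA leq_mul2l; apply/orP; right.
  rewrite [2 * _]mulnCA leq_mul2l; apply/orP; right.
  rewrite kE (_ : 8 * K * _ = z ^ 16 * (8 * (K * l))); last by lia.
  rewrite [2 * _]mulnCA leq_mul2l; apply/orP; right.
  have Klz : K * l <= z by apply: leq_trans Kl; rewrite leq_mul2l l_le orbT.
  rewrite mulnC; apply: (@leq_trans (z * z)); first by rewrite leq_mul //; lia.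
  apply: (@leq_trans (z ^ 4)); last by rewrite leq_pmull.
  by rewrite mulnn leq_pexp2l.
(* Since [(1 - 1/M) ^ M <= 1/2], missing [M * j] pairs has probability at most [2 ^ -j], and [2 ^ j]
   is at least 16 times [(z ^ 32) ^ k]. *)
pose j := 4 + 32 * (l * l) * k; pose y := M * j.
have yk : 4 * y <= k * k.
  apply: (@leq_trans (144 * (M * l * (l * k)))).
    rewrite /y /j.
    have llk : 1 <= l * l * k by rewrite muln_gt0 ll.
    rewrite (_ : 144 * _ = 4 * (M * (36 * (l * l * k)))); last by lia.
    by rewrite leq_mul // leq_mul //; lia.
  apply: (@leq_trans (144 * (z ^ 16 * (l * k)))).
    by rewrite leq_mul2l leq_mul2r Ml orbT.
  rewrite {2}kE; have : 144 <= 8 * K by lia.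
  rewrite (_ : 8 * K * _ * k = 8 * K * (z ^ 16 * (l * k))); last by lia.
  by rewrite leq_mul2r => ->; rewrite orbT.
have My : 16 * ((z ^ 30 * z ^ 2) ^ k * M.-1 ^ y) <= M ^ y.
  apply: (@leq_trans (2 ^ j * M.-1 ^ y)).
    rewrite mulnA leq_mul2r; apply/orP; right.
    rewrite /j expnD leq_mul // -expnD -expnM.
    by rewrite (_ : 32 * _ * k = l * l * ((30 + 2) * k)) //; lia.
  rewrite /y !expnM -expnMn; case: (j) => // n; rewrite leq_exp2r //.
  exact: double_expn_pred.
have sE : #|{: 'I_(z ^ 30) * 'I_(z ^ 2)}| = z ^ 32.
  by rewrite card_prod !card_ord -expnD.
have d0 : 0 < d by apply: leq_trans e2.
have NdM : 8 * z ^ 30 <= d * M.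
  rewrite /d (_ : z ^ 30 = z ^ 14 * z ^ 16); last by rewrite -expnD.
  rewrite (_ : _ * M = 8 * (z ^ 14 * (2 * (M * l)))); last by lia.
  by rewrite !leq_mul2l lM !orbT.
have cdt : 256 * 64 * d <= t.
  rewrite /d /t mulnA; exact: leq_mul K_ge (leqnn _).
have two_mono a b : a <= b -> 2 ^ a <= 2 ^ b by apply: leq_pexp2l.
have N_sigma := leq_trans N_two (two_mono _ _ e1).
have N_d := leq_trans N_two (two_mono _ _ e2).
have N_r1 := big _ t0.
have N_r2 : 16 * (z ^ 30) ^ (2 * k) <= (z ^ 8) ^ (8 * k).
  by rewrite -[X in _ <= X]expnM mulnA; apply: big.
have [G [Gs Gi Gt Ga]] := exists_triangle_free_graph (zp 30) M0 t0 (isT : 0 < 64)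
  d0 s0 k4 (leqnn _) N_sigma N_d NdM cdt N_r1 r1tM N_r2 r2N yk My.
exists ('I_(z ^ 30) * 'I_(z ^ 2))%type, G; split; first exact: sE.
split=> // I cI; apply: Ga; apply: leq_trans cI; rewrite -/k kE.
by apply: eq_leq; rewrite !mulnA.
Qed.

(** * Colorings as symmetric functions of two vertices *)

Lemma card_color : #|{: color}| = 3.
Proof. by rewrite cardT enumT unlock. Qed.

Section PairColor.
Variables (n : nat) (c : coloring n).

(** [Yellow] is the default value on the diagonal, where [[set i; j]] is not an edge. *)
Definition pair_color (i j : 'I_n) : color :=
  if insub [set i; j] is Some e then c e else Yellow.

Lemma pair_colorC i j : pair_color i j = pair_color j i.
Proof. by rewrite /pair_color setUC. Qed.

Lemma pair_colorE (e : edge n) i j : val e = [set i; j] -> c e = pair_color i j.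
Proof. by rewrite /pair_color => <-; rewrite valK. Qed.

Lemma edge_exists (i j : 'I_n) : i != j -> exists e : edge n, val e = [set i; j].
Proof.
move=> ij; have h : #|[set i; j]| == 2 by rewrite cards2 ij.
by exists (exist (fun e : {set 'I_n} => #|e| == 2) _ h).
Qed.

Lemma colors_inP (S : {set 'I_n}) x :
  reflect (exists i j, [/\ i \in S, j \in S, i != j & pair_color i j = x])
    (x \in colors_in c S).
Proof.
apply: (iffP imsetP) => [[e eS ->]|[i [j [iS jS ij <-]]]].
  have /cards2P[i [j [ij eE]]] := valP e; exists i, j.
  move: eS; rewrite inE eE subUset !sub1set => /andP[iS jS]; split=> //.
  by rewrite -(pair_colorE eE).
have [e eE] := edge_exists ij; exists e; last by rewrite (pair_colorE eE).
by rewrite inE eE subUset !sub1set iS jS.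
Qed.

Lemma card_colors_in_le x (S : {set 'I_n}) :
  (forall i j, i \in S -> j \in S -> i != j -> pair_color i j <> x) ->
  #|colors_in c S| <= 2.
Proof.
move=> nx; apply: (@leq_trans #|[set~ x]|); last by rewrite cardsC1 card_color.
apply: subset_leq_card; apply/subsetP => y /colors_inP[i [j [iS jS ij ey]]].
by rewrite !inE; apply/eqP => yx; apply: nx iS jS ij _; rewrite ey yx.
Qed.

Lemma leq_h2 x (S : {set 'I_n}) :
  (forall i j, i \in S -> j \in S -> i != j -> pair_color i j <> x) ->
  #|S| <= h2 c.
Proof.
move=> nx; rewrite /h2.
by apply: (@leq_bigmax_cond _ _ (fun S : {set 'I_n} => #|S|)); apply: card_colors_in_le nx.
Qed.

Lemma color_missing (S : {set 'I_n}) : #|colors_in c S| <= 2 ->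
  exists x, forall i j, i \in S -> j \in S -> i != j -> pair_color i j <> x.
Proof.
move=> c2; have /subsetPn[x _ xS] : ~~ ([set: color] \subset colors_in c S).
  apply/negP => /subset_leq_card; rewrite cardsT card_color => h.
  by have := leq_trans h c2.
exists x => i j iS jS ij ex; move/negP: xS; apply; apply/colors_inP.
by exists i, j.
Qed.

Lemma perm_pattern_of i j k : i != j -> i != k -> j != k ->
  perm_eq (pattern_of c [set i; j; k])
    [:: pair_color i j; pair_color i k; pair_color j k].
Proof.
move=> ij ik jk.
have [e1 E1] := edge_exists ij; have [e2 E2] := edge_exists ik.
have [e3 E3] := edge_exists jk.
rewrite -(pair_colorE E1) -(pair_colorE E2) -(pair_colorE E3).
rewrite -[[:: c e1; _; _]]/(map c [:: e1; e2; e3]); apply: perm_map.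
have edgeE (e e' : edge n) : (e == e') = (val e == val e') by [].
apply: uniq_perm; first exact: enum_uniq.
  rewrite /= !inE !edgeE E1 E2 E3 !negb_or !andbT -andbA.
  apply/and3P; split; apply/eqP => /setP h.
  - by have := h j; rewrite !inE eqxx orbT eq_sym (negbTE ij) (negbTE jk).
  - by have := h i; rewrite !inE eqxx (negbTE ij) (negbTE ik).
  - by have := h i; rewrite !inE eqxx (negbTE ij) (negbTE ik).
move=> e; rewrite mem_enum !inE !edgeE E1 E2 E3.
have /cards2P[a [b [ab ->]]] := valP e.
apply/idP/or3P.
  rewrite subUset !sub1set !inE -!orbA => /andP[/or3P[] /eqP ea /or3P[] /eqP eb];
    move: ab; rewrite ea eb ?eqxx // => _;
    by [constructor 1 | constructor 2 | constructor 3
       | constructor 1; rewrite setUC | constructor 2; rewrite setUC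
       | constructor 3; rewrite setUC].
by case=> /eqP ->; rewrite subUset !sub1set !inE !eqxx ?orbT.
Qed.

Lemma ForbP (H : seq pattern) :
  reflect (forall i j k, i != j -> i != k -> j != k ->
      ~~ has (perm_eq [:: pair_color i j; pair_color i k; pair_color j k]) H)
    (c \in Forb n H).
Proof.
have hasE i j k : i != j -> i != k -> j != k ->
    has (perm_eq (pattern_of c [set i; j; k])) H =
    has (perm_eq [:: pair_color i j; pair_color i k; pair_color j k]) H.
  by move=> ij ik jk; apply: eq_has => s; rewrite (permPl (perm_pattern_of ij ik jk)).
rewrite inE; apply: (iffP forallP) => [h i j k ij ik jk|h T].
  rewrite -hasE //; apply: (implyP (h _)).
  by rewrite setUC cardsU1 !inE cards2 ij (eq_sym k i) (eq_sym k j) (negbTE ik) (negbTE jk).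
apply/implyP => /eqP T3.
have /card_gt0P[i iT] : 0 < #|T| by rewrite T3.
have /cards2P[j [k [jk Tjk]]] : #|T :\ i| == 2.
  by move: (cardsD1 i T); rewrite iT T3 add1n => /eqP; rewrite eqSS eq_sym.
have TE : T = [set i; j; k] by rewrite -(setD1K iT) Tjk setUA.
have : i \notin [set j; k] by rewrite -Tjk setD11.
rewrite !inE negb_or => /andP[ij ik].
by rewrite TE hasE // h.
Qed.

End PairColor.

Lemma exists_coloring n (col : 'I_n -> 'I_n -> color) :
  (forall i j, col i j = col j i) ->
  exists c : coloring n, forall i j, i != j -> pair_color c i j = col i j.
Proof.
move=> colC.
(* An edge is read through an arbitrary ordering of its ends; [colC] makes the value independent of
   it. *)
exists [ffun e : edge n =>
  if [pick p : 'I_n * 'I_n | val e == [set p.1; p.2]] is Some p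
  then col p.1 p.2 else Red].
move=> i j ij; have [e eE] := edge_exists ij.
rewrite -(pair_colorE _ eE) ffunE; case: pickP => [[a b] /= /eqP|/(_ (i, j))].
  rewrite eE => ijab; have mem x : (x \in [set i; j]) = (x \in [set a; b]) by rewrite ijab.
  have := mem i; have := mem j; have := mem a; have := mem b.
  rewrite !inE !eqxx ?orbT /= => hb ha /esym hj /esym hi.
  case/orP: hi => /eqP ei; case/orP: hj => /eqP ej; rewrite -?ei -?ej //.
  - by move: ij; rewrite ei ej eqxx.
  - by move: ij; rewrite ei ej eqxx.
by rewrite /= eE eqxx.
Qed.

(** * Lower bound: greedy red-independent sets *)

(** Induction on [#|W|]. If [Y] is a neighbourhood of size at least [d], its neighbours number at
    most [d^2 <= d * #|Y|]; if no such neighbourhood is left, a single vertex has fewer than [d]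
    remaining neighbours. *)
Lemma exists_large_independent (T : finType) (R : rel T) d (W : {set T}) :
  0 < d -> symmetric R -> irreflexive R ->
  (forall u v w, R u v -> R u w -> ~~ R v w) ->
  (forall v, #|[set w | linked R v w]| <= d * d) ->
  exists I : {set T}, [/\ I \subset W,
    forall u v, u \in I -> v \in I -> ~~ R u v & #|W| <= d.+1 * #|I|].
Proof.
move=> d0 Rs Ri Rt L; have [m] := ubnP #|W|; elim: m W => // m IH W.
rewrite ltnS => Wm; have [->|[v vW]] := set_0Vmem W.
  by exists set0; split; [exact: sub0set | move=> u v; rewrite inE | rewrite cards0].
pose X w := [set u in W | R w u].
have step (Y Z : {set T}) : Y \subset W -> 0 < #|Y| ->
    (forall u w, u \in Y -> w \in Y -> ~~ R u w) ->
    (forall u w, u \in Y -> w \in W -> R u w -> w \in Z) ->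
    #|Y :|: Z| <= d.+1 * #|Y| ->
    exists I : {set T}, [/\ I \subset W,
      forall u v, u \in I -> v \in I -> ~~ R u v & #|W| <= d.+1 * #|I|].
  move=> YW Y0 Yi YZ YZc; have lt : #|W :\: (Y :|: Z)| < m.
    apply: leq_trans Wm; apply: proper_card; apply/properP; split.
      exact: subsetDl.
    by have /card_gt0P[y yY] := Y0; exists y; rewrite ?(subsetP YW) // !inE yY.
  have [I [IW Ii Ic]] := IH _ lt.
  have disj : [disjoint Y & I].
    rewrite disjoint_subset; apply/subsetP => u uY; rewrite inE; apply/negP.
    by move=> /(subsetP IW); rewrite !inE uY.
  have cross u w : u \in Y -> w \in I -> ~~ R u w.
    move=> uY /(subsetP IW); rewrite !inE negb_or => /andP[/andP[_ wZ] wW].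
    by apply: contra wZ; apply: YZ.
  exists (Y :|: I); split.
  - by rewrite subUset YW (subset_trans IW) ?subsetDl.
  - move=> u w /setUP[uY|uI] /setUP[wY|wI]; [exact: Yi|exact: cross| |exact: Ii].
    by rewrite Rs cross.
  have -> : #|Y :|: I| = #|Y| + #|I|.
    by apply/eqP; case: (leq_card_setU Y I) => _ ->.
  rewrite mulnDr -(cardsID (Y :|: Z) W) leq_add //.
  by apply: leq_trans YZc; rewrite subset_leq_card ?subsetIr.
case: (boolP [exists w in W, d <= #|X w|]) => [/exists_inP[w wW dX]|/exists_inPn small].
  apply: (step (X w) [set x | linked R w x]).
  - by apply/subsetP => u; rewrite inE => /andP[].
  - exact: leq_trans d0 dX.
  - by move=> a b; rewrite !inE => /andP[_ wa] /andP[_ wb]; apply: Rt wa wb.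
  - move=> a b; rewrite !inE => /andP[_ wa] bW ab.
    by apply/existsP; exists a; rewrite Rs wa ab.
  apply: (leq_trans (leq_card_setU _ _)); rewrite mulSn leq_add2l.
  by apply: (leq_trans (L w)); rewrite leq_mul2l dX orbT.
apply: (step [set v] (X v)).
- by rewrite sub1set.
- by rewrite cards1.
- by move=> a b; rewrite !inE => /eqP -> /eqP ->; rewrite Ri.
- by move=> a b; rewrite !inE => /eqP -> -> ->.
apply: (leq_trans (leq_card_setU _ _)); rewrite cards1 muln1 add1n ltnS.
by have := small v vW; rewrite -ltnNge => /ltnW.
Qed.

Local Notation forbidden := [:: [:: Red; Red; Red]; [:: Red; Red; Blue];
  [:: Yellow; Yellow; Blue]].

Lemma exists_square_between k : 0 < k ->
  exists2 d, 0 < d & k <= d * d <= 4 * k.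
Proof.
elim: k => // -[_ _|k IH _]; first by exists 1.
have [//|d d0 /andP[kd dk]] := IH.
case: (leqP k.+2 (d * d)) => h; first by exists d; rewrite ?h //; lia.
by exists d.+1 => //; nia.
Qed.

(** Squaring [n <= (d + 1) * k <= 2 * d * k] and using [d^2 <= 4 * k] gives [16 * k^3]; no logarithm
    is lost. *)
Lemma h2_Forb_ge n (c : coloring n) : c \in Forb n forbidden -> n ^ 2 <= 16 * h2 c ^ 3.
Proof.
move=> /ForbP cF; set k := h2 c.
have [n0|n_gt0] := posnP n; first by rewrite [X in X ^ 2]n0.
pose R i j := (i != j) && (pair_color c i j == Red).
have Rs : symmetric R by move=> i j; rewrite /R eq_sym pair_colorC.
have Ri : irreflexive R by move=> i; rewrite /R eqxx.
have Rt u v w : R u v -> R u w -> ~~ R v w.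
  move=> /andP[uv /eqP c1] /andP[uw /eqP c2]; apply/negP => /andP[vw /eqP c3].
  by have := cF u v w uv uw vw; rewrite c1 c2 c3.
have k_gt0 : 0 < k.
  have <- : #|[set Ordinal n_gt0]| = 1 by rewrite cards1.
  by apply: (@leq_h2 _ _ Red) => i j; rewrite !inE => /eqP -> /eqP ->; rewrite eqxx.
have [d d0 /andP[kd dk]] := exists_square_between k_gt0.
have L v : #|[set w | linked R v w]| <= d * d.
  (* A red path of length 2 from [v] forces a yellow edge, by [rrr] and [rrb], and two yellow
     neighbours of [v] are not joined in blue, by [yyb]. *)
  apply: leq_trans kd; pose S := v |: [set w | (v != w) && (pair_color c v w == Yellow)].
  apply: (@leq_trans #|S|).
    apply: subset_leq_card; apply/subsetP => w; rewrite !inE.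
    move=> /existsP[u /andP[/andP[uv /eqP c1] /andP[uw /eqP c2]]].
    rewrite [w == v]eq_sym; case: eqVneq => //= vw.
    by have := cF u v w uv uw vw; rewrite c1 c2; case: (pair_color c v w).
  apply: (@leq_h2 _ _ Blue) => i j.
  rewrite !inE => /orP[/eqP ->|/andP[vi /eqP ci]] /orP[/eqP ->|/andP[vj /eqP cj]] ij.
  - by rewrite eqxx in ij.
  - by rewrite cj.
  - by rewrite pair_colorC ci.
  - by move=> cij; have := cF v i j vi vj ij; rewrite ci cj cij.
have [I [_ Ii]] := exists_large_independent [set: 'I_n] d0 Rs Ri Rt L.
have Ik : #|I| <= k.
  apply: (@leq_h2 _ _ Red) => i j iI jI ij cij.
  by have := Ii _ _ iI jI; rewrite /R ij cij eqxx.
rewrite cardsT card_ord => nd.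
have : n <= 2 * d * k by apply: (leq_trans nd); rewrite leq_mul //; lia.
move=> h; apply: (@leq_trans ((2 * d * k) ^ 2)); first by rewrite leq_exp2r.
rewrite (_ : (2 * d * k) ^ 2 = 4 * k ^ 2 * (d * d)); last by rewrite !expnS !expn0; lia.
rewrite (_ : 16 * k ^ 3 = 4 * k ^ 2 * (4 * k)); last by rewrite !expnS !expn0; lia.
by rewrite leq_mul2l dk orbT.
Qed.

Lemma h2_min_ge n : n ^ 2 <= 16 * h2_min n forbidden ^ 3.
Proof.
rewrite /h2_min; elim/big_ind: _ => [|a b ha hb|c cF]; last exact: h2_Forb_ge.
  (* The neutral element [n] of the minimum satisfies the bound too. *)
  case: n => // n; rewrite [_ ^ 3]expnS mulnA leq_pmull //; lia.
by rewrite /Order.min; case: ifP.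
Qed.

(** * Upper bound: blobs joined in blue *)

Section BlowUp.
Variables (V : finType) (G : rel V) (B a n : nat).
Hypotheses (Gs : symmetric G) (Gi : irreflexive G).
Hypothesis Gt : forall u v w, G u v -> G v w -> G u w -> False.
Hypothesis Ga : forall I : {set V}, a <= #|I| ->
  exists u v, [/\ u \in I, v \in I & G u v].
Hypothesis nB : n <= B * #|V|.

Lemma card_fibers_le (S : {set 'I_n}) (g : 'I_n -> 'I_B * V) m : injective g ->
  (forall b, #|[set (g i).2 | i in [set i in S | (g i).1 == b]]| <= m) ->
  #|S| <= B * m.
Proof.
move=> gI h; rewrite -sum1_card (partition_big (fun i => (g i).1) xpredT) //=.
rewrite -[B in X in _ <= X]card_ord -sum_nat_const; apply: leq_sum => b _.
rewrite sum1dep_card; apply: leq_trans (h b); rewrite card_in_imset //.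
move=> i j; rewrite !inE => /andP[_ /eqP ib] /andP[_ /eqP jb] e.
by apply: gI; rewrite (surjective_pairing (g i)) (surjective_pairing (g j)) ib jb e.
Qed.

(** A triangle meeting several blobs has at least two blue edges, more than any forbidden pattern. A
    set without blue lies in one blob; without red it meets each blob in an independent set of [G],
    and without yellow in a clique, hence in at most 2 vertices. *)
Lemma exists_Forb_coloring : exists2 c, c \in Forb n forbidden &
  h2 c <= maxn #|V| (B * maxn 2 a).
Proof.
have cBV : #|{: 'I_B * V}| = B * #|V| by rewrite card_prod card_ord.
have nBV : n <= #|{: 'I_B * V}| by rewrite cBV.
pose g (i : 'I_n) : 'I_B * V := enum_val (widen_ord nBV i).
have gI : injective g by move=> i j /enum_val_inj/(congr1 val)/= /val_inj.
pose col (i j : 'I_n) : color := if (g i).1 != (g j).1 then Blue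
  else if G (g i).2 (g j).2 then Red else Yellow.
have colC i j : col i j = col j i by rewrite /col eq_sym Gs.
have [c cE] := exists_coloring colC.
exists c.
  apply/ForbP => i j l ij il jl; rewrite !cE // /col.
  case: (eqVneq (g i).1 (g j).1) => [e1|n1] /=; last first.
    case: (eqVneq (g i).1 (g l).1) => [e2|n2] /=.
      rewrite -e2 eq_sym n1 /=; by case: (G _ _).
    case: (eqVneq (g j).1 (g l).1) => [e3|n3] //=; by case: (G _ _).
  case: (eqVneq (g i).1 (g l).1) => [e2|n2] /=.
    rewrite -e1 e2 eqxx /=.
    case E1: (G (g i).2 (g j).2); case E2: (G (g i).2 (g l).2); case E3: (G (g j).2 (g l).2) => //.
    by case: (Gt E1 E3 E2).
  by rewrite -e1 n2 /=; case: (G _ _).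
apply/bigmax_leqP => S /color_missing[x Sx].
have {}Sx i j : i \in S -> j \in S -> i != j -> col i j <> x.
  by move=> iS jS ij; rewrite -cE //; apply: Sx.
case: x Sx => Sx.
- rewrite leq_max; apply/orP; right.
  apply: (card_fibers_le gI) => b; rewrite leq_max; apply/orP; right.
  set I := [set _ | _ in _]; case: (leqP #|I| a) => // /ltnW/Ga[u [v []]].
  move=> /imsetP[i]; rewrite inE => /andP[iS /eqP ib] ->.
  move=> /imsetP[j]; rewrite inE => /andP[jS /eqP jb] -> Gij.
  have ij : i != j by apply/eqP => e; rewrite e Gi in Gij.
  by case: (Sx i j iS jS ij); rewrite /col ib jb eqxx Gij.
- rewrite leq_max; apply/orP; left.
  have [->|[i0 i0S]] := set_0Vmem S; first by rewrite cards0.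
  have blob i : i \in S -> (g i).1 = (g i0).1.
    move=> iS; case: (eqVneq i i0) => [->//|ii0].
    have := Sx i i0 iS i0S ii0; rewrite /col.
    by case: eqVneq.
  rewrite -(card_in_imset (f := fun i => (g i).2) (D := mem S)); first exact: max_card.
  move=> i j iS jS e; apply: gI.
  by rewrite (surjective_pairing (g i)) (surjective_pairing (g j)) !blob // e.
rewrite leq_max; apply/orP; right.
apply: (card_fibers_le gI) => b; rewrite leq_max; apply/orP; left.
rewrite leqNgt; apply/negP; set I := [set _ | _ in _] => I3.
have /card_gt2P[u [v [w [[uI vI wI] [uv vw wu]]]]] := I3.
have adj x y : x \in I -> y \in I -> x != y -> G x y.
  move=> /imsetP[i]; rewrite inE => /andP[iS /eqP ib] ->.
  move=> /imsetP[j]; rewrite inE => /andP[jS /eqP jb] -> xy.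
  have ij : i != j by apply: contra xy => /eqP ->.
  have := Sx i j iS jS ij; rewrite /col ib jb eqxx /=.
  by case: (G _ _).
by case: (Gt (adj _ _ uI vI uv) (adj _ _ vI wI vw) (adj _ _ uI wI _)); rewrite eq_sym.
Qed.

End BlowUp.

(** Use [z ^ 16] blobs of [z ^ 32] vertices; sets without red dominate the maximum. *)
Lemma h2_min_le K z l n : 256 * 64 * 16 <= K -> 0 < l ->
  z <= 2 ^ (l * l) -> K * (l * l) <= z -> n <= z ^ 48 ->
  h2_min n forbidden <= 64 * K * (z ^ 32 * l).
Proof.
move=> K_ge l0 zl Klz nz.
have [V [G [cV [Gs Gi Gt Ga]]]] := exists_ramsey_graph K_ge l0 zl Klz.
have nV : n <= z ^ 16 * #|V| by rewrite cV -expnD.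
have [c cF hc] := exists_Forb_coloring Gs Gi Gt Ga nV.
have ll : 0 < l * l by rewrite muln_gt0 l0.
have K0 : 0 < K by lia.
have zp m : 0 < z ^ m.
  by rewrite expn_gt0 (leq_trans _ Klz) // muln_gt0 K0.
have le_hc : h2_min n forbidden <= h2 c.
  by rewrite -Order.NatOrder.leEnat /h2_min; apply: Order.TotalTheory.bigmin_le_cond.
apply: (leq_trans le_hc); apply: (leq_trans hc); rewrite cV geq_max.
have -> : 64 * K * (z ^ 32 * l) = z ^ 16 * (64 * K * (z ^ 16 * l)).
  by rewrite (_ : z ^ 32 = z ^ 16 * z ^ 16) -?expnD //; lia.
have zl16 : 0 < z ^ 16 * l by rewrite muln_gt0 zp.
have K64 : 2 <= 64 * K by lia.
apply/andP; split.
  rewrite (_ : 32 = 16 + 16) // expnD leq_mul2l; apply/orP; right.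
  rewrite mulnCA leq_pmulr // muln_gt0 l0 andbT; lia.
rewrite leq_mul2l geq_max leqnn andbT; apply/orP; right.
by apply: (leq_trans K64); rewrite leq_pmulr.
Qed.

(** * Parameters for arbitrary large [n] *)

Lemma sqr_le_exp2 m : 4 <= m -> m * m <= 2 ^ m.
Proof.
elim: m => // m IH; rewrite leq_eqVlt => /orP[/eqP <- //|m4].
by have := IH m4; rewrite expnS; nia.
Qed.

(** Take for [z] the 48th root of [n] rounded up, [w = z - 1], and the least [l] with
    [z <= 2 ^ (l * l)]. Rounding [l] up multiplies its square by at most 4, whence the power
    [n ^ 4]. *)
Lemma exists_parameters K : 0 < K -> exists n0, forall n, n0 < n ->
  exists z l w, [/\ 0 < l, z <= 2 ^ (l * l), K * (l * l) <= z & n <= z ^ 48] /\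
    [/\ z <= 2 * w, w ^ 48 <= n & 2 ^ (l * l) <= n ^ 4].
Proof.
move=> K0; pose A := 4 * K.
(* Beyond this threshold the least [l] exceeds [4 * K], which makes [K * (l * l)] small against
   [z]. *)
exists ((2 ^ (A * A)) ^ 48) => n n_large.
have n_gt0 : 0 < n by apply: leq_ltn_trans n_large.
have [|z nz zmin] := @ex_minnP (fun z => n <= z ^ 48).
  by exists n; rewrite -[X in X <= _]expn1 leq_pexp2l.
have [|l zl lmin] := @ex_minnP (fun l => z <= 2 ^ (l * l)).
  exists z; apply: leq_trans (ltnW (ltn_expl z (isT : 1 < 2))) _.
  by rewrite leq_pexp2l // leq_pmull // -(ltn_exp2r 0 _ (isT : 0 < 48)) exp0n // (leq_trans n_gt0).
have Al : A < l.
  rewrite ltnNge; apply/negP => lA; move: n_large; rewrite ltnNge => /negP[].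
  apply: (leq_trans nz); rewrite leq_exp2r //; apply: (leq_trans zl).
  by rewrite leq_pexp2l // leq_mul.
case: l zl lmin Al => // l zl lmin Al.
have l2z : 2 ^ (l * l) < z.
  by rewrite ltnNge; apply/negP => /lmin; rewrite ltnn.
case: z nz zmin zl lmin l2z => // z nz zmin zl lmin l2z.
have zn : z ^ 48 < n by rewrite ltnNge; apply/negP => /zmin; rewrite ltnn.
have {}Al : A <= l by [].
have l4 : 4 <= l by apply: leq_trans Al; rewrite leq_pmulr.
have ll4 : l.+1 * l.+1 <= 4 * (l * l).
  by rewrite (mulnACA 2 2) leq_mul // mul2n -addnn -addn1 leq_add2l; apply: leq_trans l4.
have {}l2z : 2 ^ (l * l) <= z by [].
have z0 : 0 < z by apply: leq_trans l2z; rewrite expn_gt0.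
exists z.+1, l.+1, z; split; split=> //.
- have AA : 4 <= l * l by apply: (leq_trans l4); rewrite leq_pmulr // (leq_trans _ l4).
  apply: leqW; apply: leq_trans l2z; apply: leq_trans (sqr_le_exp2 AA).
  apply: (leq_trans (leq_mul (leqnn K) ll4)); rewrite mulnCA mulnA leq_mul2r.
  by apply/orP; right; rewrite -/A (leq_trans Al) // leq_pmulr // (leq_trans _ l4).
- by rewrite mul2n -addnn -addn1 leq_add2l.
- exact: ltnW.
apply: (@leq_trans (2 ^ (4 * (l * l)))); first by rewrite leq_pexp2l.
rewrite mulnC expnM leq_exp2r //; apply: (@leq_trans z) => //.
by apply: leq_trans (ltnW zn); rewrite -[X in X <= _]expn1 leq_pexp2l.
Qed.

(* Translation to real asymptotics *)
From mathcomp Require Import all_classical all_reals all_analysis.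
From mathcomp Require Import lra.
Import Order.TTheory GRing.Theory Num.Theory.
Import numFieldNormedType.Exports.
Unset Implicit Arguments.
Local Open Scope classical_set_scope.
Local Open Scope ring_scope.

Lemma log2_ge1 (R : realType) (n : nat) : (2 <= n)%N -> 1 <= log2 n%:R :> R.
Proof.
move=> n2; rewrite /log2 ler_pdivlMr ?ln_gt0 ?ltr1n // mul1r.
by rewrite ler_ln ?posrE ?ltr0n ?ler_nat //; apply: leq_trans n2.
Qed.

Lemma powR_two_thirds_expn3 (R : realType) (n : nat) : (n%:R `^ (2 / 3) : R) ^+ 3 = n%:R ^+ 2.
Proof.
rewrite -powR_mulrn ?powR_ge0 // -powRrM -(@powR_mulrn _ _ 2) ?ler0n //.
by congr (_ `^ _); lra.
Qed.

(** Compare the cubes; the constant 3 suffices because [16 <= 27]. *)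
Lemma two_thirds_le (R : realType) (n h : nat) : (n ^ 2 <= 16 * h ^ 3)%N ->
  (n%:R `^ (2 / 3) : R) <= 3 * h%:R.
Proof.
move=> nh; rewrite -(@ler_pXn2r _ 3) ?nnegrE ?powR_ge0 ?mulr_ge0 ?ler0n //.
rewrite powR_two_thirds_expn3 exprMn.
have : (n ^ 2)%:R <= (16 * h ^ 3)%:R :> R by rewrite ler_nat.
rewrite natrM !natrX; have : 0 <= h%:R ^+ 3 :> R by rewrite exprn_ge0 ?ler0n.
by move: (h%:R ^+ 3) => x; rewrite !exprS expr0; lra.
Qed.

Lemma expn32_le (R : realType) (n w : nat) : (w ^ 48 <= n)%N ->
  (w%:R : R) ^+ 32 <= n%:R `^ (2 / 3).
Proof.
move=> wn; rewrite -(@ler_pXn2r _ 3) ?nnegrE ?powR_ge0 ?exprn_ge0 ?ler0n //.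
rewrite powR_two_thirds_expn3 -exprM (_ : (32 * 3 = 48 * 2)%N) // exprM.
by rewrite ler_pXn2r ?nnegrE ?exprn_ge0 ?ler0n // -natrX ler_nat.
Qed.

Lemma le_sqrt_log2 (R : realType) (n l : nat) : (0 < n)%N -> (2 ^ (l * l) <= n ^ 4)%N ->
  l%:R <= 2 * Num.sqrt (log2 n%:R) :> R.
Proof.
move=> n0 ln4; have ln2_gt0 : 0 < ln 2 :> R by rewrite ln_gt0 ?ltr1n.
have h : (l * l)%:R * ln 2 <= 4 * ln n%:R :> R.
  rewrite !mulr_natl -!lnXn ?ltr0n // ler_ln ?posrE ?exprn_gt0 ?ltr0n //.
  by rewrite -!natrX ler_nat.
have lg : (l%:R : R) ^+ 2 <= 4 * log2 n%:R.
  by rewrite /log2 mulrA ler_pdivlMr // expr2 -natrM.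
have lg0 : 0 <= log2 n%:R :> R.
  by have := le_trans (sqr_ge0 _) lg; lra.
rewrite -(@ler_pXn2r _ 2) ?nnegrE ?mulr_ge0 ?sqrtr_ge0 ?ler0n //.
by rewrite exprMn sqr_sqrtr //; apply: le_trans lg _; rewrite expr2; lra.
Qed.

Theorem lemma3p19 (R : realType) :
  let H := [:: [:: Red; Red; Red]; [:: Red; Red; Blue];
               [:: Yellow; Yellow; Blue]] in
  ((fun n : nat => (h2_min n H)%:R : R^o) =Omega_\oo
     (fun n : nat => n%:R `^ (2 / 3) / log2 n%:R `^ (1 / 3) : R^o))
  /\
  ((fun n : nat => (h2_min n H)%:R : R^o) =O_\oo
     (fun n : nat => n%:R `^ (2 / 3) * Num.sqrt (log2 n%:R) : R^o)).
Proof.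
move=> H; split.
  (* For [2 <= n] the logarithm is at least 1, so dividing by its cube root only weakens
     [n^(2/3) <= 3 * h2_min n H]. *)
  rewrite eqOmegaE eqOmegaO; apply/eqO_exP; exists 3 => //.
  near=> n; have n2 : (2 <= n)%N by near: n; exists 2.
  have lg := log2_ge1 R n n2.
  have lg1 : 1 <= (log2 n%:R : R) `^ (1 / 3).
    have e1 : (1 : R) `^ (1 / 3) = 1 by rewrite powR1.
    by rewrite -[X in X <= _]e1 ge0_ler_powR ?nnegrE //; lra.
  rewrite !ger0_norm ?ler0n ?divr_ge0 ?powR_ge0 //.
  apply: le_trans (two_thirds_le R _ _ (h2_min_ge n)).
  rewrite ler_pdivrMr; last by lra.
  by rewrite ler_peMr ?powR_ge0.
(* K stays abstract, as its unary numeral overflows the stack. *)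
have [K K_ge] := ex_intro (fun K => (256 * 64 * 16 <= K)%N) _ (leqnn _).
have K0 : (0 < K)%N by lia.
have [n0 n0P] := exists_parameters K0.
(* The factor [2 ^+ 32] comes from [z <= 2 * w], the last 2 from [l <= 2 * sqrt (log2 n)]. *)
apply/eqO_exP; exists ((64 * K)%:R * (2 ^+ 32 * 2)).
  by rewrite mulr_gt0 ?mulr_gt0 ?exprn_gt0 ?ltr0n ?muln_gt0.
near=> n; have n_gt : (n0 < n)%N by near: n; exists n0.+1.
have n_gt0 : (0 < n)%N by apply: leq_ltn_trans n_gt.
have [z [l [w [[l0 zl Klz nz] [zw wn ln4]]]]] := n0P n n_gt.
have hle := h2_min_le K_ge l0 zl Klz nz.
have A0 : 0 <= n%:R `^ (2 / 3) :> R by apply: powR_ge0.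
rewrite !ger0_norm ?ler0n ?mulr_ge0 ?sqrtr_ge0 //.
apply: (@le_trans _ _ (64 * K * (z ^ 32 * l))%:R); first by rewrite ler_nat.
rewrite natrM -!mulrA ler_wpM2l ?ler0n // natrM natrX.
apply: (@le_trans _ _ (2 ^+ 32 * n%:R `^ (2 / 3) * (2 * Num.sqrt (log2 n%:R)))).
  apply: ler_pM; rewrite ?exprn_ge0 ?ler0n //; last exact: le_sqrt_log2.
  apply: (@le_trans _ _ ((2 * w%:R) ^+ 32)).
    by rewrite lerXn2r ?nnegrE ?mulr_ge0 ?ler0n // -natrM ler_nat.
  by rewrite exprMn ler_wpM2l ?exprn_ge0 ?ler0n // expn32_le.
by rewrite -!mulrA [_ `^ _ * (2 * _)]mulrCA.
Unshelve. all: by end_near.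
Qed.
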